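(* Fix a positive natural number $\ell$. The theory $\mathcal{T_M}^+$ (defined in the context) proves the following mathematical statement. Let $U_0,\ldots,U_{\ell-1}$ be mappings from $X$ to $X$, $\varphi_0,\ldots,\varphi_{\ell-1}$ mappings from $X\times X$ to $\mathbb{R}$, and $(u_n)_{n\in\mathbb{N}}$ a sequence of elements of $X$ such that $\lim_nd(U_i(u_n),u_n)=0$ for all $i<\ell$. Let $F:=\bigcap_{i=0}^{\ell-1}Fix(U_i)$. Assume that $$\forall k\in\mathbb{N}\,\exists x\in F\,\forall y\in F\,\forall i<\ell\left(\varphi_i(x,x)<\varphi_i(x,y)+\frac{1}{k+1}\right).$$ Then $$\forall k\in\mathbb{N}\,\exists x\in F\,\exists n\in\mathbb{N}\,\forall m\geq n\,\forall i<\ell\left(\varphi_i(x,x)<\varphi_i(x,u_m)+\frac{1}{k+1}\right).$$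
   Context: **The theory $\mathcal{T_M}$** (bounded metric spaces). Language: finite types over base types $0$ (natural numbers) and $X$ (abstract metric space); $1:=0\to0$; classical many-sorted logic; the only primitive relation is $=_0$. Constants: combinators; zero, successor, recursors for G\''odel's primitive recursive functionals (all types); $d$ of type $X\to(X\to1)$; $b$ of type $0$ (a positive bound on the diameter of $X$). Reals are represented by type-$1$ functionals in signed digit representation: to each $\gamma^1$ is associated primitive recursively (in the sense of Kleene) a representation $\gamma_{\mathbb{R}}$ of a real; $=_{\mathbb{R}},\leq_{\mathbb{R}}$ are $\Pi^0_1$ and $<_{\mathbb{R}}$ is $\Sigma^0_1$. $\gamma_{[0,1]}:=\max_{\mathbb{R}}(0_{\mathbb{R}},\min_{\mathbb{R}}(1_{\mathbb{R}},\gamma_{\mathbb{R}}))$, with a fixed $l^1$ such that $\gamma_{[0,1]}(n)\leq l(n)$ always; $\forall\gamma\in[0,1](\ldots\gamma\ldots)$ stands for $\forall\gamma^1(\ldots\gamma_{[0,1]}\ldots)$, dually for $\exists$. $x=_Xy$ abbreviates $d(x,y)=_{\mathbb{R}}0_{\mathbb{R}}$. Axioms: the usual axioms for combinators and arithmetic constants (full induction scheme); Spector's weak (quantifier-free) extensionality rule; $\forall x^X,y^X\forall n^0(d(x,y)(n)=_0d(x,y)_{\mathbb{R}}(n))$; $d(x,x)=_{\mathbb{R}}0_{\mathbb{R}}$; $d(x,y)=_{\mathbb{R}}d(y,x)$; $d(x,z)\leq_{\mathbb{R}}d(x,y)+d(y,z)$; $d(x,y)\leq_{\mathbb{R}}b_{\mathbb{R}}$.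 **The theory $\mathcal{T_M}^+$.** Bounded formulas are built from atomic formulas by propositional connectives and the bounded quantifications $\forall k\leq_0n$, $\exists k\leq_0n$, $\forall x^X$, $\exists x^X$, $\forall\gamma\in[0,1]$, $\exists\gamma\in[0,1]$. A $\Sigma$-formula has the form $\exists n^0B(n)$ with $B$ bounded. For $f$ of type $1$, $\tilde f(n):=\max_{k\leq n}f(k)$. $\mathcal{T_M}^+$ is $\mathcal{T_M}$ plus, for all $\Sigma$-formulas $A$ (possibly with parameters): bounded choice $\forall n^0\exists k^0A(n,k)\to\exists f^1\forall n\exists k\leq\tilde f(n)A(n,k)$; and bounded collection $\forall i\leq_0m\exists n^0A(i,n)\to\exists n\forall i\leq m\exists k\leq nA(i,k)$, $\forall\gamma\in[0,1]\exists n^0A(\gamma,n)\to\exists n\forall\gamma\in[0,1]\exists k\leq nA(\gamma,k)$, $\forall x^X\exists n^0A(x,n)\to\exists n\forall x^X\exists k\leq nA(x,k)$. The mathematical statement is understood as formalized in this language: the $U_i$ are variables of type $X\to X$, $(u_n)$ of type $0\to X$, the $\varphi_i$ of type $X\to(X\to1)$ (real-valued via representations); since $\ell$ is a fixed numeral, ''$\forall i<\ell$'' stands for a finite conjunction; $x\in Fix(U_i)$ means $U_i(x)=_Xx$; $\lim_nd(U_i(u_n),u_n)=0$ means $\forall r\exists n\forall m\geq n\,(d(U_i(u_m),u_m)\leq\frac{1}{r+1})$; no extensionality or continuity is assumed. *)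

(* Defs.v *)
From Stdlib Require Import List.
From Stdlib Require Vectors.Fin.

Set Implicit Arguments.
Unset Strict Implicit.
Unset Printing Implicit Defensive.

(* A deep embedding: many-sorted terms and formulas over the finite types,
   intrinsically typed with de Bruijn indices, and derivability in the theories
   T_M and T_M^+ as an inductive predicate. *)

(** * Finite types, contexts and variables *)

Inductive ty : Type :=
| tN : ty
| tX : ty
| Arr : ty -> ty -> ty.

Notation "s ~> t" := (Arr s t) (at level 55, right associativity).
Notation one := (tN ~> tN).

Definition ctx := list ty.

Inductive var : ctx -> ty -> Type :=
| vz (G : ctx) (s : ty) : var (s :: G) s
| vs (G : ctx) (s t : ty) : var G t -> var (s :: G) t.
Arguments vz {G s}.
Arguments vs {G s t} _.

Definition vcase (G : ctx) (s : ty) (P : ty -> Type)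
    (pz : P s) (ps : forall t, var G t -> P t) (t : ty) (v : var (s :: G) t) : P t :=
  match v in var G' t' return
    match G' with
    | nil => unit
    | s' :: G'' => P s' -> (forall t, var G'' t -> P t) -> P t'
    end with
  | vz => fun a _ => a
  | vs w => fun _ f => f _ w
  end pz ps.

(** * Terms *)

(* [cK] and [cS] are the combinators, [cR] the recursors, [cd] the metric and
   [cb] the bound on the diameter. *)
Inductive term (G : ctx) : ty -> Type :=
| Var t : var G t -> term G t
| App s t : term G (s ~> t) -> term G s -> term G t
| cK s t : term G (s ~> t ~> s)
| cS r s t : term G ((r ~> s ~> t) ~> (r ~> s) ~> r ~> t)
| c0 : term G tN
| cSucc : term G one
| cR s : term G (tN ~> s ~> (s ~> tN ~> s) ~> s)
| cd : term G (tX ~> tX ~> one)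
| cb : term G tN.
Arguments cK {G s t}.
Arguments cS {G r s t}.
Arguments c0 {G}.
Arguments cSucc {G}.
Arguments cR {G s}.
Arguments cd {G}.
Arguments cb {G}.

Declare Scope term_scope.
Delimit Scope term_scope with T.
Bind Scope term_scope with term.
Open Scope term_scope.

Notation "f @ a" := (App f a) (at level 29, left associativity) : term_scope.

Notation v0 := (Var vz).
Notation v1 := (Var (vs vz)).
Notation v2 := (Var (vs (vs vz))).
Notation v3 := (Var (vs (vs (vs vz)))).
Notation v4 := (Var (vs (vs (vs (vs vz))))).

Definition renaming (G D : ctx) := forall t, var G t -> var D t.
Definition substitution (G D : ctx) := forall t, var G t -> term D t.

Definition upr (G D : ctx) (s : ty) (f : renaming G D) : renaming (s :: G) (s :: D) :=
  vcase (P := var (s :: D)) vz (fun t v => vs (f t v)).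

Fixpoint ren (G D : ctx) (f : renaming G D) (t : ty) (a : term G t) : term D t :=
  match a with
  | Var v => Var (f _ v)
  | App g b => App (ren f g) (ren f b)
  | cK => cK
  | cS => cS
  | c0 => c0
  | cSucc => cSucc
  | cR => cR
  | cd => cd
  | cb => cb
  end.

Definition shift (G : ctx) (s : ty) : renaming G (s :: G) := fun t v => vs v.
Definition wk (G : ctx) (s t : ty) (a : term G t) : term (s :: G) t :=
  ren (@shift G s) a.
Arguments wk {G s t} a.

Definition ups (G D : ctx) (s : ty) (f : substitution G D)
    : substitution (s :: G) (s :: D) :=
  vcase (P := term (s :: D)) v0 (fun t v => wk (f t v)).

Fixpoint subst (G D : ctx) (f : substitution G D) (t : ty) (a : term G t) : term D t :=
  match a with
  | Var v => f _ v
  | App g b => App (subst f g) (subst f b)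
  | cK => cK
  | cS => cS
  | c0 => c0
  | cSucc => cSucc
  | cR => cR
  | cd => cd
  | cb => cb
  end.

Definition scons (G D : ctx) (s : ty) (a : term D s) (f : substitution G D)
    : substitution (s :: G) D :=
  vcase (P := term D) a f.
Definition ids (G : ctx) : substitution G G := fun t v => Var v.
Definition inst (G : ctx) (s t : ty) (r : term (s :: G) t) (a : term G s) : term G t :=
  subst (scons a (@ids G)) r.

(** Bracket abstraction: lambda terms are not primitive but are compiled to
    combinators. *)

Fixpoint drop0 (G : ctx) (s t : ty) (a : term (s :: G) t) : option (term G t) :=
  match a with
  | Var v => vcase (P := fun t => option (term G t)) None (fun t w => Some (Var w)) v
  | App f b =>
      match drop0 f, drop0 b with
      | Some f', Some b' => Some (App f' b')
      | _, _ => None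
      end
  | cK => Some cK
  | cS => Some cS
  | c0 => Some c0
  | cSucc => Some cSucc
  | cR => Some cR
  | cd => Some cd
  | cb => Some cb
  end.

Fixpoint lam (G : ctx) (s t : ty) (a : term (s :: G) t) : term G (s ~> t) :=
  match a in term _ t return term G (s ~> t) with
  | Var v => vcase (P := fun t => term G (s ~> t))
               (cS @ cK @ (cK (t := s))) (fun t w => cK @ Var w) v
  | App f b =>
      match drop0 f, drop0 b with
      | Some f', Some b' => cK @ (f' @ b')
      | _, _ => cS @ lam f @ lam b
      end
  | cK => cK @ cK
  | cS => cK @ cS
  | c0 => cK @ c0
  | cSucc => cK @ cSucc
  | cR => cK @ cR
  | cd => cK @ cd
  | cb => cK @ cb
  end.

(** * Primitive recursive arithmetic *)

Section Arithmetic.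
Context {G : ctx}.

Definition add : term G (tN ~> tN ~> tN) :=
  lam (lam (cR @ v0 @ v1 @ lam (lam (cSucc @ v1)))).
Definition prd : term G one := lam (cR @ v0 @ c0 @ lam (lam v0)).
End Arithmetic.
Notation "a + b" := (add @ a @ b) : term_scope.

Definition sub {G : ctx} : term G (tN ~> tN ~> tN) :=
  lam (lam (cR @ v0 @ v1 @ lam (lam (prd @ v1)))).
Notation "a - b" := (sub @ a @ b) : term_scope.

Definition mul {G : ctx} : term G (tN ~> tN ~> tN) :=
  lam (lam (cR @ v0 @ c0 @ lam (lam (v1 + v3)))).
Notation "a * b" := (mul @ a @ b) : term_scope.

Fixpoint num {G : ctx} (n : nat) : term G tN :=
  match n with O => c0 | S n => cSucc @ num n end.

Definition maxN {G : ctx} : term G (tN ~> tN ~> tN) := lam (lam (v1 + (v0 - v1))).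
Definition minN {G : ctx} : term G (tN ~> tN ~> tN) := lam (lam (v1 - (v1 - v0))).
Definition pow2 {G : ctx} : term G one := lam (cR @ v0 @ num 1 @ lam (lam (v1 + v1))).

(* floor(n/2), by  half (n+1) = n - half n. *)
Definition half {G : ctx} : term G one := lam (cR @ v0 @ c0 @ lam (lam (v0 - v1))).

(* divS m k = floor(m/(k+1)): the quotient increases from m to m+1 exactly when
   (q+1)(k+1) <= m+1. *)
Definition divS {G : ctx} : term G (tN ~> tN ~> tN) :=
  lam (lam (cR @ v1 @ c0 @
    lam (lam (v1 + (num 1 - ((cSucc @ v1) * (cSucc @ v2) - cSucc @ v0)))))).

(* f~(n) = max_{k <= n} f(k) *)
Definition tilde {G : ctx} : term G (one ~> one) :=
  lam (lam (cR @ v0 @ (v1 @ c0) @ lam (lam (maxN @ v1 @ (v3 @ (cSucc @ v0)))))).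

(** * Formulas *)

Inductive form (G : ctx) : Type :=
| Eq : term G tN -> term G tN -> form G
| Bot : form G
| And : form G -> form G -> form G
| Or : form G -> form G -> form G
| Imp : form G -> form G -> form G
| All s : form (s :: G) -> form G
| Ex s : form (s :: G) -> form G.
Arguments Bot {G}.
Arguments All {G} s _.
Arguments Ex {G} s _.

Definition Neg {G : ctx} (A : form G) : form G := Imp A Bot.
Definition Top {G : ctx} : form G := Imp Bot Bot.

Fixpoint fren (G D : ctx) (f : renaming G D) (A : form G) : form D :=
  match A with
  | Eq a b => Eq (ren f a) (ren f b)
  | Bot => Bot
  | And A B => And (fren f A) (fren f B)
  | Or A B => Or (fren f A) (fren f B)
  | Imp A B => Imp (fren f A) (fren f B)
  | All s A => All s (fren (upr f) A)
  | Ex s A => Ex s (fren (upr f) A)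
  end.

Fixpoint fsubst (G D : ctx) (f : substitution G D) (A : form G) : form D :=
  match A with
  | Eq a b => Eq (subst f a) (subst f b)
  | Bot => Bot
  | And A B => And (fsubst f A) (fsubst f B)
  | Or A B => Or (fsubst f A) (fsubst f B)
  | Imp A B => Imp (fsubst f A) (fsubst f B)
  | All s A => All s (fsubst (ups f) A)
  | Ex s A => Ex s (fsubst (ups f) A)
  end.

Definition fwk (G : ctx) (s : ty) (A : form G) : form (s :: G) := fren (@shift G s) A.
Arguments fwk {G s} A.
Definition finst (G : ctx) (s : ty) (A : form (s :: G)) (a : term G s) : form G :=
  fsubst (scons a (@ids G)) A.

Fixpoint closure (G : ctx) : form G -> form nil :=
  match G with
  | nil => fun A => A
  | s :: G => fun A => closure (All s A)
  end.

Definition le0 (G : ctx) (a b : term G tN) : form G := Eq (a - b) c0.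
Definition AllLe (G : ctx) (b : term G tN) (A : form (tN :: G)) : form G :=
  All tN (Imp (le0 v0 (wk b)) A).
Definition ExLe (G : ctx) (b : term G tN) (A : form (tN :: G)) : form G :=
  Ex tN (And (le0 v0 (wk b)) A).

Fixpoint bigAnd {G : ctx} (l : nat) : (Fin.t l -> form G) -> form G :=
  match l with
  | O => fun _ => Top
  | S l => fun A => And (A Fin.F1) (bigAnd (fun i => A (Fin.FS i)))
  end.

(** * Real numbers in signed digit representation *)

(* A type-1 functional g represents the real number
     z(g 0) + sum_{i >= 1} (min (g i) 2 - 1) / 2^i,
   where z(2m) = m and z(2m+1) = -(m+1): the entries after the first code the
   digits -1, 0, 1 by 0, 1, 2. *)

Definition toR {G : ctx} : term G (one ~> one) :=
  lam (lam (cR @ v0 @ (v1 @ c0) @ lam (lam (minN @ (v3 @ (cSucc @ v0)) @ num 2)))).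

(* z(c) = decP c - decN c, one of the two being 0. *)
Definition odd {G : ctx} : term G one := lam (v0 - (half @ v0 + half @ v0)).
Definition decP {G : ctx} : term G one := lam (half @ v0 * (num 1 - odd @ v0)).
Definition decN {G : ctx} : term G one := lam (half @ (cSucc @ v0) * (odd @ v0)).
(* the code of the integer p - q *)
Definition code {G : ctx} : term G (tN ~> tN ~> tN) :=
  lam (lam (((v1 - v0) + (v1 - v0)) + (((v0 - v1) + (v0 - v1)) - num 1))).

(* For x represented by g, write A_n = apP g n - apN g n.  Then A_n / 2^n is the
   partial sum up to the n-th digit, so |x - A_n / 2^n| <= 1 / 2^n, and
   A_{n+1} - 2 A_n is the (n+1)-st digit. *)
Definition apP {G : ctx} : term G (one ~> one) :=
  lam (lam (cR @ v0 @ (decP @ (toR @ v1 @ c0))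
    @ lam (lam ((v1 + v1) + toR @ v3 @ (cSucc @ v0))))).
Definition apN {G : ctx} : term G (one ~> one) :=
  lam (lam (cR @ v0 @ (decN @ (toR @ v1 @ c0))
    @ lam (lam (cSucc @ (v1 + v1))))).

(* Conversely, the representation with partial sums (p n - q n) / 2^n, for p and q
   such that (p (n+1) - q (n+1)) - 2 (p n - q n) always lies in {-1, 0, 1}. *)
Definition ofSums {G : ctx} : term G (one ~> one ~> one) :=
  lam (lam (lam (cR @ v0 @ (code @ (v2 @ c0) @ (v1 @ c0))
    @ lam (lam ((cSucc @ ((v4 @ (cSucc @ v0)) + (v3 @ v0 + v3 @ v0)))
                - (v3 @ (cSucc @ v0) + (v4 @ v0 + v4 @ v0))))))).

Definition natR {G : ctx} : term G (tN ~> one) :=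
  lam (ofSums @ lam (v1 * (pow2 @ v0)) @ lam c0).
(* 1/(k+1), with partial sums floor(2^n/(k+1)) / 2^n *)
Definition invR {G : ctx} : term G (tN ~> one) :=
  lam (ofSums @ lam (divS @ (pow2 @ v0) @ v1) @ lam c0).

(* max and min act on the partial sums directly; A_{n+1} - 2 A_n stays a digit. *)
Definition maxR {G : ctx} : term G (one ~> one ~> one) :=
  lam (lam (ofSums
    @ lam (maxN @ (apP @ v2 @ v0 + apN @ v1 @ v0) @ (apP @ v1 @ v0 + apN @ v2 @ v0))
    @ lam (apN @ v2 @ v0 + apN @ v1 @ v0))).
Definition minR {G : ctx} : term G (one ~> one ~> one) :=
  lam (lam (ofSums
    @ lam (minN @ (apP @ v2 @ v0 + apN @ v1 @ v0) @ (apP @ v1 @ v0 + apN @ v2 @ v0))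
    @ lam (apN @ v2 @ v0 + apN @ v1 @ v0))).

(* With S_n the sum of the partial sums' numerators A_n and B_n, the sum has partial
   sums E_n / 2^n for E_n = floor((S_{n+2} + 2) / 4).  For a pair (p, q) standing for
   p - q this floor is floor((p + 3q + 2) / 4) - q.  One checks that
   E_{n+1} - 2 E_n is in {-1, 0, 1} by cases on S_{n+2} mod 4. *)
Definition addR {G : ctx} : term G (one ~> one ~> one) :=
  lam (lam (
    ofSums
    @ lam (half @ (half @ (
          (apP @ v2 @ (cSucc @ (cSucc @ v0)) + apP @ v1 @ (cSucc @ (cSucc @ v0)))
          + num 3 * (apN @ v2 @ (cSucc @ (cSucc @ v0)) + apN @ v1 @ (cSucc @ (cSucc @ v0)))
          + num 2)))
    @ lam (apN @ v2 @ (cSucc @ (cSucc @ v0)) + apN @ v1 @ (cSucc @ (cSucc @ v0))))).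

(* The relations on represented reals, in terms of the partial sums A_n / 2^n and
   B_n / 2^n:  a <= b  iff  A_n <= B_n + 2 for all n. *)
Definition leR (G : ctx) (a b : term G one) : form G :=
  All tN (le0 (apP @ wk a @ v0 + apN @ wk b @ v0)
            ((apP @ wk b @ v0 + apN @ wk a @ v0) + num 2)).
Definition ltR (G : ctx) (a b : term G one) : form G :=
  Ex tN (le0 (cSucc @ ((apP @ wk a @ v0 + apN @ wk b @ v0) + num 2))
           (apP @ wk b @ v0 + apN @ wk a @ v0)).
Definition eqR (G : ctx) (a b : term G one) : form G :=
  All tN (And (le0 (apP @ wk a @ v0 + apN @ wk b @ v0)
                 ((apP @ wk b @ v0 + apN @ wk a @ v0) + num 2))
             (le0 (apP @ wk b @ v0 + apN @ wk a @ v0)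
                 ((apP @ wk a @ v0 + apN @ wk b @ v0) + num 2))).

(* g_[0,1] = max(0, min(1, g)); all its entries are at most 2. *)
Definition unitR {G : ctx} : term G (one ~> one) :=
  lam (maxR @ (natR @ num 0) @ (minR @ (natR @ num 1) @ (toR @ v0))).

(* Replace the variable 0 by its truncation to [0,1]. *)
Definition at01 (G : ctx) (A : form (one :: G)) : form (one :: G) :=
  fsubst (vcase (P := term (one :: G)) (unitR @ v0) (fun t v => Var (vs v))) A.
Definition All01 (G : ctx) (A : form (one :: G)) : form G := All one (at01 A).
Definition Ex01 (G : ctx) (A : form (one :: G)) : form G := Ex one (at01 A).

(** * Equality in all types *)

Definition eqX (G : ctx) (a b : term G tX) : form G := eqR (cd @ a @ b) (natR @ num 0).

Fixpoint eqT (G : ctx) (t : ty) : term G t -> term G t -> form G :=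
  match t with
  | tN => fun a b => Eq a b
  | tX => fun a b => eqX a b
  | s ~> t => fun a b => All s (eqT (wk a @ v0) (wk b @ v0))
  end.

(** * Classes of formulas *)

Inductive qf (G : ctx) : form G -> Prop :=
| qf_eq a b : qf (Eq a b)
| qf_bot : qf Bot
| qf_and A B : qf A -> qf B -> qf (And A B)
| qf_or A B : qf A -> qf B -> qf (Or A B)
| qf_imp A B : qf A -> qf B -> qf (Imp A B).

Inductive bounded (G : ctx) : form G -> Prop :=
| bd_eq a b : bounded (Eq a b)
| bd_bot : bounded Bot
| bd_and A B : bounded A -> bounded B -> bounded (And A B)
| bd_or A B : bounded A -> bounded B -> bounded (Or A B)
| bd_imp A B : bounded A -> bounded B -> bounded (Imp A B)
| bd_allle b A : @bounded (tN :: G) A -> bounded (AllLe b A)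
| bd_exle b A : @bounded (tN :: G) A -> bounded (ExLe b A)
| bd_allX A : @bounded (tX :: G) A -> bounded (All tX A)
| bd_exX A : @bounded (tX :: G) A -> bounded (Ex tX A)
| bd_all01 A : @bounded (one :: G) A -> bounded (All01 A)
| bd_ex01 A : @bounded (one :: G) A -> bounded (Ex01 A).

Inductive sigma (G : ctx) : form G -> Prop :=
| sigma_ex B : @bounded (tN :: G) B -> sigma (Ex tN B).

(** * Derivability *)

(* Classical natural deduction from the axioms [Ax], with hypotheses [H] and free
   variables in [G].  [nonempty] is needed because free variables are declared in a
   context: as usual in many-sorted logic every sort is inhabited (for the types
   other than those ending in [tX] there are closed terms anyway).  The weak
   extensionality rule applies only to premises derived without hypotheses. *)
Inductive derives (Ax : forall G, form G -> Prop) (G : ctx) (H : list (form G))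
    : form G -> Prop :=
| ax A : Ax G A -> derives Ax H A
| hyp A : In A H -> derives Ax H A
| raa A : derives Ax (Neg A :: H) Bot -> derives Ax H A
| andI A B : derives Ax H A -> derives Ax H B -> derives Ax H (And A B)
| andE1 A B : derives Ax H (And A B) -> derives Ax H A
| andE2 A B : derives Ax H (And A B) -> derives Ax H B
| orI1 A B : derives Ax H A -> derives Ax H (Or A B)
| orI2 A B : derives Ax H B -> derives Ax H (Or A B)
| orE A B C : derives Ax H (Or A B) -> derives Ax (A :: H) C -> derives Ax (B :: H) C ->
    derives Ax H C
| impI A B : derives Ax (A :: H) B -> derives Ax H (Imp A B)
| impE A B : derives Ax H (Imp A B) -> derives Ax H A -> derives Ax H B
| allI s (A : form (s :: G)) : derives Ax (map (@fwk G s) H) A -> derives Ax H (All s A)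
| allE s (A : form (s :: G)) a : derives Ax H (All s A) -> derives Ax H (finst A a)
| exI s (A : form (s :: G)) a : derives Ax H (finst A a) -> derives Ax H (Ex s A)
| exE s (A : form (s :: G)) C : derives Ax H (Ex s A) ->
    derives Ax (A :: map (@fwk G s) H) (fwk C) -> derives Ax H C
| nonempty s A : derives Ax (map (@fwk G s) H) (fwk A) -> derives Ax H A
| eq0_refl a : derives Ax H (Eq a a)
| eq0_subst a b A : derives Ax H (Eq a b) -> derives Ax H (finst A a) ->
    derives Ax H (finst A b)
| qf_er s t (A : form G) (a b : term G s) (r : term (s :: G) t) : qf A ->
    derives Ax nil (Imp A (eqT a b)) ->
    derives Ax H (Imp A (eqT (inst r a) (inst r b))).

Inductive TM_axiom (G : ctx) : form G -> Prop :=
| ax_K s t (a : term G s) (b : term G t) : TM_axiom (eqT (cK @ a @ b) a)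
| ax_S r s t (a : term G (r ~> s ~> t)) (b : term G (r ~> s)) (c : term G r) :
    TM_axiom (eqT (cS @ a @ b @ c) (a @ c @ (b @ c)))
| ax_R0 s (a : term G s) (f : term G (s ~> tN ~> s)) : TM_axiom (eqT (cR @ c0 @ a @ f) a)
| ax_RS s (a : term G s) (f : term G (s ~> tN ~> s)) (n : term G tN) :
    TM_axiom (eqT (cR @ (cSucc @ n) @ a @ f) (f @ (cR @ n @ a @ f) @ n))
| ax_succ0 (n : term G tN) : TM_axiom (Neg (Eq (cSucc @ n) c0))
| ax_succI (m n : term G tN) : TM_axiom (Imp (Eq (cSucc @ m) (cSucc @ n)) (Eq m n))
| ax_ind (A : form (tN :: G)) :
    TM_axiom (Imp (finst A c0)
      (Imp (All tN (Imp A (fsubst (vcase (P := term (tN :: G)) (cSucc @ v0)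
                                    (fun t v => Var (vs v))) A)))
        (All tN A)))
| ax_dR (x y : term G tX) (n : term G tN) :
    TM_axiom (Eq (cd @ x @ y @ n) (toR @ (cd @ x @ y) @ n))
| ax_dxx (x : term G tX) : TM_axiom (eqR (cd @ x @ x) (natR @ num 0))
| ax_dsym (x y : term G tX) : TM_axiom (eqR (cd @ x @ y) (cd @ y @ x))
| ax_dtri (x y z : term G tX) :
    TM_axiom (leR (cd @ x @ z) (addR @ (cd @ x @ y) @ (cd @ y @ z)))
| ax_db (x y : term G tX) : TM_axiom (leR (cd @ x @ y) (natR @ cb)).

(* [skip2 A] weakens the formula A(v1, v0) by a variable of type s placed below v1. *)
Definition skip2 (G : ctx) (s t u : ty) (A : form (t :: u :: G)) : form (t :: u :: s :: G) :=
  fren (upr (upr (@shift G s))) A.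

Inductive TMplus_axiom (G : ctx) : form G -> Prop :=
| ax_TM A : TM_axiom A -> TMplus_axiom A
| ax_choice (A : form (tN :: tN :: G)) : sigma A ->
    TMplus_axiom (Imp (All tN (Ex tN A))
      (Ex one (All tN (ExLe (tilde @ v1 @ v0) (skip2 one A)))))
| ax_coll_nat (m : term G tN) (A : form (tN :: tN :: G)) : sigma A ->
    TMplus_axiom (Imp (AllLe m (Ex tN A))
      (Ex tN (AllLe (wk m) (ExLe v1 (skip2 tN A)))))
| ax_coll_01 (A : form (tN :: one :: G)) : sigma A ->
    TMplus_axiom (Imp (All01 (Ex tN A)) (Ex tN (All01 (ExLe v1 (skip2 tN A)))))
| ax_coll_X (A : form (tN :: tX :: G)) : sigma A ->
    TMplus_axiom (Imp (All tX (Ex tN A)) (Ex tN (All tX (ExLe v1 (skip2 tN A))))).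

Definition TM_proves (A : form nil) : Prop := derives TM_axiom nil A.
Definition TMplus_proves (A : form nil) : Prop := derives TMplus_axiom nil A.

(** * Families of variables *)

Fixpoint rep (s : ty) (l : nat) (G : ctx) : ctx :=
  match l with O => G | S l => s :: rep s l G end.

Fixpoint rep_var (s : ty) (G : ctx) (l : nat) (i : Fin.t l) : var (rep s l G) s :=
  match i with
  | Fin.F1 => vz
  | Fin.FS i => vs (rep_var s G i)
  end.

Fixpoint rep_skip (s : ty) (G : ctx) (l : nat) (t : ty) (v : var G t) : var (rep s l G) t :=
  match l with
  | O => v
  | S l => vs (rep_skip s l v)
  end.

(* The context of the variables (u_n), phi_0, ..., phi_{l-1}, U_0, ..., U_{l-1}. *)
Definition data (l : nat) : ctx :=
  (tN ~> tX) :: rep (tX ~> tX ~> one) l (rep (tX ~> tX) l nil).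
Definition useq {l : nat} : term (data l) (tN ~> tX) := v0.
Definition phi {l : nat} (i : Fin.t l) : term (data l) (tX ~> tX ~> one) :=
  Var (vs (rep_var _ _ i)).
Definition Umap {l : nat} (i : Fin.t l) : term (data l) (tX ~> tX) :=
  Var (vs (rep_skip _ l (rep_var _ nil i))).

(* lim_n d(U(u_n), u_n) = 0 *)
Definition asymptotic (G : ctx) (U : term G (tX ~> tX)) (u : term G (tN ~> tX)) : form G :=
  All tN (Ex tN (All tN (Imp (le0 v1 v0)
    (leR (cd @ (wk (wk (wk U)) @ (wk (wk (wk u)) @ v0)) @ (wk (wk (wk u)) @ v0))
         (invR @ v2))))).

Definition inF (G : ctx) (l : nat) (U : Fin.t l -> term G (tX ~> tX)) (x : term G tX) : form G :=
  bigAnd (fun i => eqX (U i @ x) x).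

(* phi_i(x,x) < phi_i(x,y) + 1/(k+1)  for all i < l *)
Definition almost_min (G : ctx) (l : nat) (p : Fin.t l -> term G (tX ~> tX ~> one))
    (k : term G tN) (x y : term G tX) : form G :=
  bigAnd (fun i => ltR (p i @ x @ x) (addR @ (p i @ x @ y) @ (invR @ k))).

(* Main.v *)
Require Import Defs.
From Stdlib Require Import List.
From Stdlib Require Vectors.Fin.
From Stdlib Require Import Arith Setoid Morphisms Classical.
From mathcomp Require classical_sets.

(* For fixed x, the matrix "if every d(U_j(y), y) is zero up to the precision 2^-n,
   then phi_i(x,x) < phi_i(x,y) + 1/(k+1) is visible at the precision n" holds for every y
   and some n, by cases on y in F.  It is bounded, so collection over X yields an N that
   bounds n for all y at once; points with d(U_j(y), y) <= 1/(2^N + 1) for all j then satisfy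
   the conclusion of the implication, and these include all late u_m.

   Derivability is reduced to truth in maximal consistent theories over a fixed list of free
   variables; quantifiers are read off the one-variable extensions of such a theory. *)

Set Implicit Arguments.
Unset Strict Implicit.
Unset Printing Implicit Defensive.
Set Bullet Behavior "Strict Subproofs".

(** Nothing links [U_i], [phi_i] and equality on X, so a point with small [d(U_j(y), y)] cannot be
    exchanged for a nearby fixed point; only uniformity in y is available. Collection moreover
    yields, for each y, some precision below N rather than N itself. A point chosen after N must
    therefore satisfy the premise of the matrix at every precision n <= N, literally as a statement
    about n-th partial sums. Two facts about signed digits make this exact. The partial sums of
    1/(2^N + 1) vanish up to N, which fails at N for 1/2^N; so a distance bounded by it satisfies
    one half of the equation with 0 at each n <= N, with the same tolerance 2. The other half says
    that the numerators of the partial sums of a distance are at least -2. This is not an axiom: it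
    is extracted from d(x,x) = 0, symmetry and the triangle inequality, and it is the reason why the
    addition of represented reals has to be analysed. *)

(** * Renaming and substitution *)

Lemma var_split (G : ctx) (s : ty) (P : forall t, var (s :: G) t -> Prop) :
  P s vz -> (forall t (v : var G t), P t (vs v)) -> forall t (v : var (s :: G) t), P t v.
Proof.
intros Hz Hs t v.
(* Inversion without axioms on the equality of types: the return type is trivial over [nil], and [P]
   is abstracted so that its context may vary with the variable. *)
refine (match v as v' in var D t' return
          match D as D0 return var D0 t' -> Prop with
          | nil => fun _ => True
          | s' :: G' => fun v0 => forall Q : (forall t, var (s' :: G') t -> Prop),
              Q s' vz -> (forall t (v : var G' t), Q t (vs v)) -> Q t' v0
          end v' with
        | @vz _ _ => fun Q HQ _ => HQ
        | @vs _ _ _ w => fun Q _ HQ => HQ _ w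
        end P Hz Hs).
Qed.

Definition rsub (G D : ctx) (f : renaming G D) : substitution G D := fun t v => Var (f t v).
Definition scomp (G D E : ctx) (g : substitution D E) (f : substitution G D) :
  substitution G E := fun t v => subst g (f t v).

Lemma subst_ext (G D : ctx) (f g : substitution G D) t (a : term G t) :
  (forall t v, f t v = g t v) -> subst f a = subst g a.
Proof. intros E; induction a; simpl; congruence. Qed.

Lemma ren_subst (G D : ctx) (f : renaming G D) t (a : term G t) :
  ren f a = subst (rsub f) a.
Proof. induction a; simpl; unfold rsub in *; congruence. Qed.

Lemma subst_subst (G D E : ctx) (g : substitution D E) (f : substitution G D) t
    (a : term G t) : subst g (subst f a) = subst (scomp g f) a.
Proof. induction a; simpl; unfold scomp in *; congruence. Qed.

Lemma subst_ids (G : ctx) t (a : term G t) : subst (@ids G) a = a.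
Proof. induction a; simpl; unfold ids in *; congruence. Qed.

Lemma wk_subst (G : ctx) s t (a : term G t) : wk (s := s) a = subst (rsub (@shift G s)) a.
Proof. apply ren_subst. Qed.

Lemma subst_ups_wk (G D : ctx) (f : substitution G D) s t (a : term G t) :
  subst (ups (s := s) f) (wk a) = wk (subst f a).
Proof.
rewrite !wk_subst, !subst_subst; apply subst_ext; intros t' v.
unfold scomp, rsub, shift; simpl; rewrite wk_subst; reflexivity.
Qed.

Lemma subst_vcase_wk (G D : ctx) (f : substitution G D) s (b : term D s) t (a : term G t) :
  subst (vcase (P := term D) b f) (wk a) = subst f a.
Proof. rewrite wk_subst, subst_subst; apply subst_ext; reflexivity. Qed.

Lemma subst_scons_wk (G D : ctx) (f : substitution G D) s (b : term D s) t (a : term G t) :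
  subst (scons b f) (wk a) = subst f a.
Proof. apply subst_vcase_wk. Qed.

Lemma subst_shift (G : ctx) s t (a : term G t) :
  subst (fun t v => Var (vs (s := s) v)) a = wk a.
Proof. symmetry; apply wk_subst. Qed.

Lemma ren_upr_wk (G D : ctx) (f : renaming G D) s t (a : term G t) :
  ren (upr (s := s) f) (wk a) = wk (ren f a).
Proof.
unfold wk; rewrite !ren_subst, !subst_subst; apply subst_ext; reflexivity.
Qed.

Lemma upr_rsub (G D : ctx) (f : renaming G D) s t (v : var (s :: G) t) :
  rsub (upr f) v = ups (rsub f) v.
Proof. revert t v; apply var_split; reflexivity. Qed.

Lemma ups_ext (G D : ctx) (f g : substitution G D) s :
  (forall t v, f t v = g t v) -> forall t v, ups (s := s) f (t := t) v = ups g v.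
Proof. intros E; apply var_split; [reflexivity | intros t v; simpl; rewrite E; reflexivity]. Qed.

Lemma fsubst_ext (G : ctx) (A : form G) : forall (D : ctx) (f g : substitution G D),
  (forall t v, f t v = g t v) -> fsubst f A = fsubst g A.
Proof.
induction A; intros D f g E; simpl; f_equal;
  auto using subst_ext, ups_ext.
Qed.

Lemma fren_fsubst (G : ctx) (A : form G) : forall (D : ctx) (f : renaming G D),
  fren f A = fsubst (rsub f) A.
Proof.
induction A; intros D f; simpl; rewrite ?ren_subst; f_equal; auto.
all: rewrite IHA; apply fsubst_ext, upr_rsub.
Qed.

Lemma ups_scomp (G D E : ctx) (g : substitution D E) (f : substitution G D) s t
    (v : var (s :: G) t) : scomp (ups g) (ups f) v = ups (scomp g f) v.
Proof.
revert t v; apply var_split; [reflexivity | intros t v].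
unfold scomp; simpl; rewrite subst_ups_wk; reflexivity.
Qed.

Lemma fsubst_fsubst (G : ctx) (A : form G) : forall (D E : ctx)
    (g : substitution D E) (f : substitution G D),
  fsubst g (fsubst f A) = fsubst (scomp g f) A.
Proof.
induction A; intros D E g f; simpl; rewrite ?subst_subst; f_equal; auto.
all: rewrite IHA; apply fsubst_ext, ups_scomp.
Qed.

Lemma fsubst_ids (G : ctx) (A : form G) : fsubst (@ids G) A = A.
Proof.
induction A; simpl; rewrite ?subst_ids; f_equal; auto.
all: rewrite <- IHA at 2; apply fsubst_ext; apply var_split; reflexivity.
Qed.

Lemma finst_fwk (G : ctx) s (A : form G) (a : term G s) : finst (fwk A) a = A.
Proof.
unfold finst, fwk; rewrite fren_fsubst, fsubst_fsubst.
rewrite <- (fsubst_ids A) at 2; apply fsubst_ext; reflexivity.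
Qed.

Lemma finst_upr_v0 (G : ctx) s (A : form (s :: G)) :
  finst (fren (upr (@shift G s)) A) v0 = A.
Proof.
unfold finst; rewrite fren_fsubst, fsubst_fsubst.
rewrite <- (fsubst_ids A) at 2; apply fsubst_ext; apply var_split; reflexivity.
Qed.

(** * Bracket abstraction *)

Lemma drop0_wk (G : ctx) s t (a : term G t) : drop0 (wk (s := s) a) = Some a.
Proof. unfold wk; induction a; simpl; try rewrite IHa1, IHa2; reflexivity. Qed.

Lemma drop0_Some (G : ctx) s t (a : term (s :: G) t) :
  forall a', drop0 a = Some a' -> a = wk a'.
Proof.
induction a as [t v | s' t f IHf b IHb | | | | | | | ]; intros a'; simpl;
  try (intros [= <-]; reflexivity).
- revert t v a'; apply (var_split (P := fun t v => forall a',
    vcase (P := fun t => option (term G t)) None (fun t w => Some (Var w)) v = Some a' ->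
    Var v = wk a')); simpl; [discriminate | intros t v a' [= <-]; reflexivity].
- destruct (drop0 f), (drop0 b); try discriminate; intros [= <-].
  rewrite (IHf _ eq_refl), (IHb _ eq_refl); reflexivity.
Qed.

Lemma lam_wk (G : ctx) s t (a : term G t) : lam (wk (s := s) a) = cK @ a.
Proof.
destruct a as [| s' t f b | | | | | | | ]; try reflexivity.
change (wk (s := s) (f @ b)) with (wk (s := s) f @ wk b); simpl.
rewrite !drop0_wk; reflexivity.
Qed.

Lemma drop0_subst (G D : ctx) (f : substitution G D) s t (a : term (s :: G) t) :
  drop0 (subst (ups f) a) = option_map (@subst _ _ f t) (drop0 a).
Proof.
induction a as [t v | s' t g IHg b IHb | | | | | | | ]; simpl; try reflexivity.
- revert t v; apply var_split; simpl; [reflexivity | intros; apply drop0_wk].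
- rewrite IHg, IHb; destruct (drop0 g), (drop0 b); reflexivity.
Qed.

(** Compilation commutes with substitution syntactically because the test [drop0] does: a
    substitution under the binder neither creates nor removes the bound variable. For a free
    variable the substituted term is arbitrary, and [lam_wk] ensures that its weakening compiles at
    once to a constant function. *)
Lemma subst_lam (G D : ctx) (f : substitution G D) s t (a : term (s :: G) t) :
  subst f (lam a) = lam (subst (ups f) a).
Proof.
induction a as [t v | s' t g IHg b IHb | | | | | | | ]; try reflexivity.
- revert t v; apply var_split; [reflexivity | intros t v; simpl; rewrite lam_wk; reflexivity].
- simpl; rewrite !drop0_subst; destruct (drop0 g), (drop0 b); simpl;
    try reflexivity; rewrite IHg, IHb; reflexivity.
Qed.

(** * Maximal consistent theories *)

Lemma weakening (Ax : forall G, form G -> Prop) (G : ctx) (H : list (form G)) (A : form G) :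
  derives Ax H A -> forall H', incl H H' -> derives Ax H' A.
Proof.
induction 1; intros H' HH.
- apply ax; assumption.
- apply hyp; auto.
- apply raa; apply IHderives; intros x [<- | Hx]; simpl; auto.
- apply andI; auto.
- eapply andE1; eauto.
- eapply andE2; eauto.
- apply orI1; auto.
- apply orI2; auto.
- apply (orE (A := A) (B := B)); auto.
  + apply IHderives2; intros x [<- | Hx]; simpl; auto.
  + apply IHderives3; intros x [<- | Hx]; simpl; auto.
- apply impI; apply IHderives; intros x [<- | Hx]; simpl; auto.
- eapply impE; eauto.
- apply allI; apply IHderives, incl_map, HH.
- apply allE; auto.
- eapply exI; eauto.
- eapply exE; [eauto |]; apply IHderives2; intros x [<- | Hx]; simpl; auto.
  right; revert x Hx; apply incl_map, HH.
- eapply nonempty; apply IHderives, incl_map, HH.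
- apply eq0_refl.
- eapply eq0_subst; eauto.
- apply qf_er; assumption.
Qed.

Notation der := (derives TMplus_axiom).

(** A deductively closed, consistent and complete set of formulas. Henkin witnesses are not
    demanded, as the fixed context leaves no room for fresh variables. *)
Record theory (G : ctx) := Theory {
  holds :> form G -> Prop;
  holds_der : forall H A, (forall B, In B H -> holds B) -> der H A -> holds A;
  holds_Bot : ~ holds Bot;
  holds_em : forall A, holds A \/ holds (Neg A) }.

Definition consistent (G : ctx) (S : form G -> Prop) : Prop :=
  forall H, (forall B, In B H -> S B) -> ~ der H Bot.

Lemma split_premises (X : Type) (P : X -> Prop) (A : X) (H : list X) :
  (forall B, In B H -> P B \/ B = A) ->
  exists H', (forall B, In B H' -> P B) /\ incl H (A :: H').
Proof.
induction H as [| C H IH]; intros HH.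
- exists nil; split; [intros B [] | intros x []].
- destruct IH as [H' [HP Hi]]; [intros B HB; apply HH; right; exact HB |].
  destruct (HH C (or_introl eq_refl)) as [PC | ->].
  + exists (C :: H'); split; [intros B [<- | HB]; auto |].
    intros x [<- | Hx]; [right; left; reflexivity |].
    destruct (Hi x Hx) as [<- | Hx']; [left; reflexivity | right; right; exact Hx'].
  + exists H'; split; [exact HP |].
    intros x [<- | Hx]; [left; reflexivity | exact (Hi x Hx)].
Qed.

Lemma lindenbaum (G : ctx) (S : form G -> Prop) :
  consistent S -> exists T : theory G, forall A, S A -> T A.
Proof.
intros HS.
(* The candidates are the sets to be added to [S], not those containing it: the empty chain has the
   empty union, which is then admissible by consistency of [S]. *)
set (P := fun D : form G -> Prop => consistent (fun B => S B \/ D B)).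
destruct (classical_sets.Zorn_bigcup (T := form G) (P := P)) as [D [HD Dmax]].
{ intros F HF Ftot H HH Hder.
  (* A derivation has finitely many premises, so in a nonempty chain a single member already covers
     all those outside [S]. *)
  assert (E : (exists X, F X /\ forall B, In B H -> S B \/ X B) \/
              (forall B, In B H -> S B)).
  { clear Hder; induction H as [| B H IH]; [right; intros B [] |].
    destruct IH as [[X [FX HX]] | HX]; [intros C HC; apply HH; right; exact HC | |].
    - destruct (HH B (or_introl eq_refl)) as [SB | [Y FY YB]].
      + left; exists X; split; [exact FX |]; intros C [<- | HC]; auto.
      + left; destruct (Ftot X Y FX FY) as [XY | YX].
        * exists Y; split; [exact FY |]; intros C [<- | HC]; auto.
          destruct (HX C HC); auto.
        * exists X; split; [exact FX |]; intros C [<- | HC]; auto.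
    - destruct (HH B (or_introl eq_refl)) as [SB | [Y FY YB]].
      + right; intros C [<- | HC]; auto.
      + left; exists Y; split; [exact FY |]; intros C [<- | HC]; auto. }
  destruct E as [[X [FX HX]] | HX].
  - exact (HF X FX H HX Hder).
  - exact (HS H HX Hder). }
set (T := fun B : form G => S B \/ D B) in *.
assert (Tadd : forall A, consistent (fun B => T B \/ B = A) -> T A).
{ intros A HA; right.
  destruct (classic (D A)) as [DA | nDA]; [exact DA |].
  exfalso; apply (Dmax (fun B => D B \/ B = A)).
  - split; [intros B DB; left; exact DB |].
    intros sub; apply nDA, sub; right; reflexivity.
  - intros H HH; apply HA; intros B HB; unfold T; destruct (HH B HB) as [| []]; auto. }
assert (Tder : forall H A, (forall B, In B H -> T B) -> der H A -> T A).
{ intros H A HH Hder; apply Tadd; intros H' HH' HB.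
  destruct (split_premises HH') as [H2 [H2T H2i]].
  apply (HD (H ++ H2)).
  - intros B HB'; apply in_app_or in HB'; destruct HB'; [apply HH | apply H2T]; assumption.
  - apply impE with A.
    + apply impI; apply (weakening HB); intros x Hx.
      destruct (H2i x Hx) as [<- | Hx']; [left; reflexivity |].
      right; apply in_or_app; right; exact Hx'.
    + apply (weakening Hder); intros x Hx; apply in_or_app; left; exact Hx. }
assert (Tbot : ~ T Bot).
{ intros TB; apply (HD (Bot :: nil)); [intros B [<- | []]; exact TB | apply hyp; left; reflexivity]. }
assert (Tem : forall A, T A \/ T (Neg A)).
{ intros A; destruct (classic (T A)) as [TA | nTA]; [left; exact TA | right].
  apply NNPP; intros nTN; apply nTA, Tadd; intros H HH Hder; apply nTN.
  destruct (split_premises HH) as [H2 [H2T H2i]].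
  apply (Tder H2); [exact H2T |].
  apply impI; exact (weakening Hder H2i). }
exists (Theory Tder Tbot Tem); intros A SA; left; exact SA.
Qed.

Section Connectives.
Context {G : ctx} (T : theory G).

Lemma holds_der0 A : der nil A -> T A.
Proof. apply holds_der; intros B []. Qed.

Lemma holds_der1 A B : der (A :: nil) B -> T A -> T B.
Proof. intros D HA; refine (holds_der _ D); intros C [<- | []]; exact HA. Qed.

Lemma holds_der2 A B C : der (A :: B :: nil) C -> T A -> T B -> T C.
Proof. intros D HA HB; refine (holds_der _ D); intros E [<- | [<- | []]]; assumption. Qed.

Local Ltac hy := apply hyp; simpl; auto.

(** From right to left, completeness decides [A]: either [B] holds too, or [Neg A] does and the
    implication is vacuous. *)
Lemma holds_Imp A B : T (Imp A B) <-> (T A -> T B).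
Proof.
split.
- apply holds_der2; apply impE with A; hy.
- intros HAB; destruct (holds_em T A) as [HA | HA].
  + apply (holds_der1 (A := B)); [apply impI; hy | auto].
  + revert HA; apply holds_der1; apply impI, raa.
    apply impE with A; hy.
Qed.

Lemma holds_Neg A : T (Neg A) <-> ~ T A.
Proof.
unfold Neg; rewrite holds_Imp; split; intros HA TA; [exact (holds_Bot (HA TA)) | contradiction].
Qed.

Lemma holds_And A B : T (And A B) <-> T A /\ T B.
Proof.
split.
- intros HAB; split; revert HAB; apply holds_der1; [eapply andE1 | eapply andE2]; hy.
- intros [HA HB]; revert HA HB; apply holds_der2; apply andI; hy.
Qed.

Lemma holds_Or A B : T (Or A B) <-> T A \/ T B.
Proof.
split.
- intros HAB; apply NNPP; intros N.
  assert (HA : T (Neg A)) by (apply holds_Neg; tauto).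
  assert (HB : T (Neg B)) by (apply holds_Neg; tauto).
  apply (holds_Bot (t := T)).
  apply (holds_der (t := T) (H := Or A B :: Neg A :: Neg B :: nil)).
  + intros C [<- | [<- | [<- | []]]]; assumption.
  + apply orE with A B; [hy | apply impE with A; hy | apply impE with B; hy].
- intros [HA | HB]; [revert HA | revert HB]; apply holds_der1; [apply orI1 | apply orI2]; hy.
Qed.

Lemma holds_allE s (A : form (s :: G)) a : T (All s A) -> T (finst A a).
Proof. apply holds_der1, allE; hy. Qed.

Lemma holds_exI s (A : form (s :: G)) a : T (finst A a) -> T (Ex s A).
Proof. apply holds_der1; apply exI with a; hy. Qed.

Lemma holds_bigAnd l (A : Fin.t l -> form G) : T (bigAnd A) <-> forall i, T (A i).
Proof.
induction l as [| l IH]; simpl.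
- split; [intros _ i; inversion i | intros _; apply holds_Imp; auto].
- rewrite holds_And, IH; split.
  + intros [H0 HS] i; revert A H0 HS.
    refine (match i in Fin.t n return match n return Fin.t n -> Prop with
       | O => fun _ => True
       | S n => fun i => forall A : Fin.t (S n) -> form G, T (A Fin.F1) ->
           (forall j, T (A (Fin.FS j))) -> T (A i) end i with
       | @Fin.F1 _ => fun A H0 _ => H0 | @Fin.FS _ j => fun A _ HS => HS j end).
  + auto.
Qed.

End Connectives.

(* An equivalence rather than an implication, as [T] is maximal. *)
Definition ext (G : ctx) s (T : theory G) (T' : theory (s :: G)) : Prop :=
  forall A, T' (fwk A) <-> T A.

(** The condition is exactly what fails if [T] refutes an existential statement (by [exE]) or proves
    a universal one (by [allI] and [raa], with the negated body as [A]). *)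
Lemma consistent_ext (G : ctx) s (T : theory G) (A : form (s :: G)) :
  (forall H, (forall B, In B H -> T B) -> ~ der (A :: map (@fwk G s) H) Bot) ->
  exists T' : theory (s :: G), ext T T' /\ T' A.
Proof.
intros HA.
destruct (@lindenbaum (s :: G) (fun B => B = A \/ exists C, T C /\ B = fwk C)) as [T' HT'].
- intros H HH Hder.
  destruct (@split_premises _ (fun B => exists C, T C /\ B = fwk C) A H) as [H2 [H2T H2i]].
  { intros B HB; destruct (HH B HB); auto. }
  assert (E : exists H3, (forall B, In B H3 -> T B) /\ H2 = map (@fwk G s) H3).
  { clear H2i; induction H2 as [| B H2 IH].
    - exists nil; split; [intros B [] | reflexivity].
    - destruct IH as [H3 [H3T ->]]; [auto using in_cons |].
      destruct (H2T B (or_introl eq_refl)) as [C [TC ->]].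
      exists (C :: H3); split; [intros B [<- | HB]; auto | reflexivity]. }
  destruct E as [H3 [H3T ->]].
  exact (HA H3 H3T (weakening Hder H2i)).
- exists T'; split; [| apply HT'; left; reflexivity].
  assert (up : forall C, T C -> T' (fwk C)) by (intros C TC; apply HT'; right; eauto).
  intros C; split; [| apply up].
  intros TC; destruct (holds_em T C) as [| N]; [assumption | exfalso].
  apply up in N; apply (holds_Neg T' (fwk C)) in N; contradiction.
Qed.

Lemma holds_All (G : ctx) (T : theory G) s (A : form (s :: G)) :
  T (All s A) <-> forall T', ext T T' -> T' A.
Proof.
split.
- intros HA T' E; apply E in HA; simpl in HA.
  apply (holds_allE v0) in HA; rewrite finst_upr_v0 in HA; exact HA.
- intros HA; apply NNPP; intros N.
  destruct (@consistent_ext G s T (Neg A)) as [T' [E HN]].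
  + intros H HT Hder; apply N; apply (holds_der HT), allI, raa, Hder.
  + apply holds_Neg in HN; auto.
Qed.

Lemma holds_Ex (G : ctx) (T : theory G) s (A : form (s :: G)) :
  T (Ex s A) <-> exists T', ext T T' /\ T' A.
Proof.
split.
- intros HA; apply consistent_ext; intros H HT Hder.
  apply (holds_Bot (t := T)).
  apply (holds_der (t := T) (H := Ex s A :: H)); [intros B [<- | HB]; auto |].
  apply exE with s A; [apply hyp; left; reflexivity |].
  apply (weakening Hder); intros x [<- | Hx]; simpl; auto.
- intros [T' [E HA]]; apply E; simpl.
  apply holds_exI with v0; rewrite finst_upr_v0; exact HA.
Qed.

Lemma derives_of_theories (G : ctx) (A : form G) : (forall T : theory G, T A) -> der nil A.
Proof.
intros HA; apply NNPP; intros N.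
destruct (@lindenbaum G (fun B => B = Neg A)) as [T HT].
- intros H HH Hder; apply N, raa, (weakening Hder).
  intros B HB; left; symmetry; exact (HH B HB).
- apply (holds_Neg T A); auto.
Qed.

Lemma derives_closure (G : ctx) (A : form G) : der nil A -> TMplus_proves (closure A).
Proof.
induction G as [| s G IH]; [exact (fun D => D) |].
intros D; apply IH, (allI (H := nil)), D.
Qed.

(** * Conversion *)

(** Indiscernibility in contexts of type 0. Without extensionality the pointwise [eqT] cannot be
    shown to be a congruence; this relation is one at every type, so it supports rewriting. *)
Definition teq (G : ctx) (T : theory G) t (a b : term G t) : Prop :=
  forall r : term (t :: G) tN, T (Eq (inst r a) (inst r b)).
Definition tle (G : ctx) (T : theory G) (a b : term G tN) : Prop := T (le0 a b).
Notation "a ==[ T ] b" := (teq T a%T b%T) (at level 70, T at level 0).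
Notation "a <=[ T ] b" := (tle T a%T b%T) (at level 70, T at level 0).

Lemma inst_wk (G : ctx) s t (a : term G t) (b : term G s) : inst (wk a) b = a.
Proof. unfold inst; rewrite subst_scons_wk; apply subst_ids. Qed.

Section Conversion.
Context {G : ctx} (T : theory G).

Lemma holds_eq_refl (a : term G tN) : T (Eq a a).
Proof. apply holds_der0, eq0_refl. Qed.

Lemma holds_eq_subst (A : form (tN :: G)) a b : T (Eq a b) -> T (finst A a) -> T (finst A b).
Proof.
apply holds_der2; apply eq0_subst with a; apply hyp; simpl; auto.
Qed.

Lemma teq_Eq (a b : term G tN) : teq T a b <-> T (Eq a b).
Proof.
split; [intros E; exact (E v0) |].
intros E r.
assert (X := @holds_eq_subst (Eq (wk (inst r a)) r) a b E).
unfold finst in X; simpl in X; fold (inst (wk (inst r a)) a) in X.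
fold (inst (wk (inst r a)) b) (inst r a) (inst r b) in X.
rewrite !inst_wk in X; apply X, holds_eq_refl.
Qed.

Lemma teq_refl t (a : term G t) : teq T a a.
Proof. intros r; apply holds_eq_refl. Qed.

Lemma Eq_sym (a b : term G tN) : T (Eq a b) -> T (Eq b a).
Proof.
intros E; assert (X := @holds_eq_subst (Eq v0 (wk a)) a b E).
unfold finst in X; simpl in X; rewrite !subst_scons_wk, !subst_ids in X.
apply X, holds_eq_refl.
Qed.

Lemma Eq_trans (a b c : term G tN) : T (Eq a b) -> T (Eq b c) -> T (Eq a c).
Proof.
intros E E'; assert (X := @holds_eq_subst (Eq (wk a) v0) b c E').
unfold finst in X; simpl in X; rewrite !subst_scons_wk, !subst_ids in X; auto.
Qed.

Lemma teq_sym t (a b : term G t) : teq T a b -> teq T b a.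
Proof. intros E r; apply Eq_sym, E. Qed.

Lemma teq_trans t (a b c : term G t) : teq T a b -> teq T b c -> teq T a c.
Proof. intros E E' r; exact (Eq_trans (E r) (E' r)). Qed.

Lemma teq_App s t (f f' : term G (s ~> t)) (a a' : term G s) :
  teq T f f' -> teq T a a' -> teq T (f @ a) (f' @ a').
Proof.
(* A context around an application is also a context around either factor: the hole is replaced by
   the application with its other factor kept fixed. The two factors are then exchanged one after
   the other. *)
assert (in_hole : forall u (h : term (u :: G) t) (r : term (t :: G) tN) (c : term G u),
  inst (subst (scons h (fun _ v => Var (vs v))) r) c = inst r (inst h c)).
{ intros u h r c; unfold inst; rewrite subst_subst; apply subst_ext.
  apply var_split; reflexivity. }
intros Ef Ea r; apply Eq_trans with (inst r (f' @ a)).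
- generalize (Ef (subst (scons (v0 @ wk a) (fun _ v => Var (vs v))) r)).
  rewrite !in_hole; unfold inst at 2 4; simpl.
  rewrite !subst_scons_wk, !subst_ids; exact (fun E => E).
- generalize (Ea (subst (scons (wk f' @ v0) (fun _ v => Var (vs v))) r)).
  rewrite !in_hole; unfold inst at 2 4; simpl.
  rewrite !subst_scons_wk, !subst_ids; exact (fun E => E).
Qed.

(** The weak extensionality rule asks for an equation derived without hypotheses. Axioms qualify,
    unlike equations merely true in [T]; [Top] serves as the quantifier-free premise. *)
Lemma teq_axiom t (a b : term G t) : TM_axiom (eqT a b) -> teq T a b.
Proof.
intros E r; apply (proj1 (holds_Imp T Top (Eq (inst r a) (inst r b)))).
- apply holds_der0, (@qf_er TMplus_axiom G nil t tN Top a b r).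
  + apply qf_imp; apply qf_bot.
  + apply impI, ax, ax_TM, E.
- apply holds_Imp; auto.
Qed.

End Conversion.

#[global] Instance teq_Equivalence (G : ctx) (T : theory G) t : Equivalence (@teq G T t).
Proof.
split; [intros a; apply teq_refl | intros a b; apply teq_sym | intros a b c; apply teq_trans].
Qed.

#[global] Instance App_Proper (G : ctx) (T : theory G) s t :
  Proper (@teq G T (s ~> t) ==> @teq G T s ==> @teq G T t) (@App G s t).
Proof. intros f f' Ef a a' Ea; apply teq_App; assumption. Qed.

Lemma tle_teq (G : ctx) (T : theory G) (a b : term G tN) : a <=[T] b <-> a - b ==[T] c0.
Proof. symmetry; apply teq_Eq. Qed.

#[global] Instance tle_Proper (G : ctx) (T : theory G) :
  Proper (@teq G T tN ==> @teq G T tN ==> iff) (@tle G T).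
Proof. intros a a' Ea b b' Eb; rewrite !tle_teq, Ea, Eb; reflexivity. Qed.

(** * Reduction rules and induction *)

Section Reduction.
Context {G : ctx} (T : theory G).

Lemma K_eq s t (a : term G s) (b : term G t) : cK @ a @ b ==[T] a.
Proof. apply teq_axiom, ax_K. Qed.
Lemma S_eq r s t (a : term G (r ~> s ~> t)) (b : term G (r ~> s)) (c : term G r) :
  cS @ a @ b @ c ==[T] a @ c @ (b @ c).
Proof. apply teq_axiom, ax_S. Qed.
Lemma R0_eq s (a : term G s) (f : term G (s ~> tN ~> s)) : cR @ c0 @ a @ f ==[T] a.
Proof. apply teq_axiom, ax_R0. Qed.
Lemma RS_eq s (a : term G s) (f : term G (s ~> tN ~> s)) (n : term G tN) :
  cR @ (cSucc @ n) @ a @ f ==[T] f @ (cR @ n @ a @ f) @ n.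
Proof. apply teq_axiom, ax_RS. Qed.

Lemma beta s t (r : term (s :: G) t) (a : term G s) : lam r @ a ==[T] inst r a.
Proof.
induction r as [t v | s' t f IHf b IHb | | | | | | | ];
  try (unfold inst; simpl; rewrite K_eq; reflexivity).
- revert t v; apply var_split.
  + simpl; rewrite S_eq, K_eq; reflexivity.
  + intros t v; simpl; rewrite K_eq; reflexivity.
- simpl; destruct (drop0 f) as [f' |] eqn:Ef, (drop0 b) as [b' |] eqn:Eb;
    try (rewrite S_eq, IHf, IHb; reflexivity).
  rewrite K_eq, (drop0_Some Ef), (drop0_Some Eb).
  change (inst (wk f' @ wk b') a) with (inst (wk f') a @ inst (wk b') a).
  rewrite !inst_wk; reflexivity.
Qed.

Definition succ_v0 : substitution (tN :: G) (tN :: G) :=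
  vcase (P := term (tN :: G)) (cSucc @ v0) (fun t v => Var (vs v)).

(** The induction step is argued in an arbitrary extension [T'], so case distinctions outside the
    formal system are allowed there. As [T'] lives in a larger context, lemmas used in the step must
    hold for all contexts and theories. *)
Lemma holds_ind (A : form (tN :: G)) n : T (finst A c0) ->
  (forall T' : theory (tN :: G), ext T T' -> T' A -> T' (fsubst succ_v0 A)) ->
  T (finst A n).
Proof.
intros H0 HS; apply holds_allE.
assert (X : T (Imp (finst A c0) (Imp (All tN (Imp A (fsubst succ_v0 A))) (All tN A))))
  by apply holds_der0, ax, ax_TM, ax_ind.
rewrite !holds_Imp in X; apply X; [exact H0 |].
apply holds_All; intros T' E; apply holds_Imp; auto.
Qed.

Lemma holds_ind_eq (a b : term (tN :: G) tN) n : inst a c0 ==[T] inst b c0 ->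
  (forall T' : theory (tN :: G), ext T T' -> a ==[T'] b ->
     subst succ_v0 a ==[T'] subst succ_v0 b) ->
  inst a n ==[T] inst b n.
Proof.
intros H0 HS; apply teq_Eq; apply (@holds_ind (Eq a b)); [apply teq_Eq, H0 |].
intros T' E IH; apply teq_Eq, HS; [exact E | apply teq_Eq, IH].
Qed.

End Reduction.

(** * Substitution into the closed constants, and reduction tactics *)

Lemma subst_add (G D : ctx) (f : substitution G D) : subst f add = add.
Proof. reflexivity. Qed.
Lemma subst_prd (G D : ctx) (f : substitution G D) : subst f prd = prd.
Proof. reflexivity. Qed.
Lemma subst_sub (G D : ctx) (f : substitution G D) : subst f sub = sub.
Proof. reflexivity. Qed.
Lemma subst_mul (G D : ctx) (f : substitution G D) : subst f mul = mul.
Proof. reflexivity. Qed.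
Lemma subst_minN (G D : ctx) (f : substitution G D) : subst f minN = minN.
Proof. reflexivity. Qed.
Lemma subst_pow2 (G D : ctx) (f : substitution G D) : subst f pow2 = pow2.
Proof. reflexivity. Qed.
Lemma subst_half (G D : ctx) (f : substitution G D) : subst f half = half.
Proof. reflexivity. Qed.
Lemma subst_divS (G D : ctx) (f : substitution G D) : subst f divS = divS.
Proof. reflexivity. Qed.
Lemma subst_toR (G D : ctx) (f : substitution G D) : subst f toR = toR.
Proof. reflexivity. Qed.
Lemma subst_odd (G D : ctx) (f : substitution G D) : subst f odd = odd.
Proof. reflexivity. Qed.
Lemma subst_decP (G D : ctx) (f : substitution G D) : subst f decP = decP.
Proof. reflexivity. Qed.
Lemma subst_decN (G D : ctx) (f : substitution G D) : subst f decN = decN.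
Proof. reflexivity. Qed.
Lemma subst_code (G D : ctx) (f : substitution G D) : subst f code = code.
Proof. reflexivity. Qed.
Lemma subst_apP (G D : ctx) (f : substitution G D) : subst f apP = apP.
Proof. reflexivity. Qed.
Lemma subst_apN (G D : ctx) (f : substitution G D) : subst f apN = apN.
Proof. reflexivity. Qed.
Lemma subst_ofSums (G D : ctx) (f : substitution G D) : subst f ofSums = ofSums.
Proof. reflexivity. Qed.
Lemma subst_natR (G D : ctx) (f : substitution G D) : subst f natR = natR.
Proof. reflexivity. Qed.
Lemma subst_invR (G D : ctx) (f : substitution G D) : subst f invR = invR.
Proof. reflexivity. Qed.
Lemma subst_addR (G D : ctx) (f : substitution G D) : subst f addR = addR.
Proof. reflexivity. Qed.

(* Unfolding [lam] makes conversion tests blow up. *)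
#[global] Opaque lam drop0.
#[global] Strategy 100 [add prd sub mul minN pow2 half divS toR odd decP decN code
  apP apN ofSums natR invR addR].

Ltac sbst1 := match goal with
  | |- context [subst ?f (lam ?a)] => rewrite (subst_lam f a)
  | |- context [subst (ups ?f) (wk ?a)] => rewrite (subst_ups_wk f _ a)
  | |- context [subst (scons ?b ?f) (wk ?a)] => rewrite (subst_scons_wk f b a)
  | |- context [subst (vcase ?b ?f) (wk ?a)] => rewrite (subst_vcase_wk f b a)
  | |- context [subst (@ids _) ?a] => rewrite (subst_ids a)
  | |- context [subst (fun t v => Var (vs v)) ?a] => rewrite (subst_shift _ a)
  | |- context [@subst ?G ?D ?f ?t (@add ?G)] => rewrite (@subst_add G D f)
  | |- context [@subst ?G ?D ?f ?t (@prd ?G)] => rewrite (@subst_prd G D f)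
  | |- context [@subst ?G ?D ?f ?t (@sub ?G)] => rewrite (@subst_sub G D f)
  | |- context [@subst ?G ?D ?f ?t (@mul ?G)] => rewrite (@subst_mul G D f)
  | |- context [@subst ?G ?D ?f ?t (@minN ?G)] => rewrite (@subst_minN G D f)
  | |- context [@subst ?G ?D ?f ?t (@pow2 ?G)] => rewrite (@subst_pow2 G D f)
  | |- context [@subst ?G ?D ?f ?t (@half ?G)] => rewrite (@subst_half G D f)
  | |- context [@subst ?G ?D ?f ?t (@divS ?G)] => rewrite (@subst_divS G D f)
  | |- context [@subst ?G ?D ?f ?t (@toR ?G)] => rewrite (@subst_toR G D f)
  | |- context [@subst ?G ?D ?f ?t (@odd ?G)] => rewrite (@subst_odd G D f)
  | |- context [@subst ?G ?D ?f ?t (@decP ?G)] => rewrite (@subst_decP G D f)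
  | |- context [@subst ?G ?D ?f ?t (@decN ?G)] => rewrite (@subst_decN G D f)
  | |- context [@subst ?G ?D ?f ?t (@code ?G)] => rewrite (@subst_code G D f)
  | |- context [@subst ?G ?D ?f ?t (@apP ?G)] => rewrite (@subst_apP G D f)
  | |- context [@subst ?G ?D ?f ?t (@apN ?G)] => rewrite (@subst_apN G D f)
  | |- context [@subst ?G ?D ?f ?t (@ofSums ?G)] => rewrite (@subst_ofSums G D f)
  | |- context [@subst ?G ?D ?f ?t (@natR ?G)] => rewrite (@subst_natR G D f)
  | |- context [@subst ?G ?D ?f ?t (@invR ?G)] => rewrite (@subst_invR G D f)
  | |- context [@subst ?G ?D ?f ?t (@addR ?G)] => rewrite (@subst_addR G D f)
  end.
Ltac sbst := unfold inst, finst, succ_v0; repeat progress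
  (cbn [subst fsubst scons ups vcase ids num le0]; repeat sbst1).
Ltac red_lam := repeat progress (rewrite ?beta; sbst).
Ltac red_eqs := red_lam; rewrite ?R0_eq, ?RS_eq; red_lam; try reflexivity.
(* [lem] is an instance of [holds_ind] or [holds_ind_eq], stated up to substitutions. *)
Ltac induct lem :=
  let X := fresh in let IH := fresh "IH" in let T' := fresh "T'" in let E := fresh "E" in
  match type of lem with ?A -> ?B -> ?C =>
  assert (X : C);
  [ apply lem; [| intros T' E IH]; sbst
  | revert X; sbst; try exact (fun X => X) ] end.

(** * Addition, truncated subtraction and multiplication *)

Section Arith.
Context {G : ctx} (T : theory G).
Implicit Types a b c n : term G tN.

Lemma add_0r a : a + c0 ==[T] a.
Proof. unfold add; red_eqs. Qed.
Lemma add_Sr a b : a + cSucc @ b ==[T] cSucc @ (a + b).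
Proof. unfold add; red_eqs. Qed.
Lemma prd_0 : prd @ c0 ==[T] c0.
Proof. unfold prd; red_eqs. Qed.
Lemma prd_S a : prd @ (cSucc @ a) ==[T] a.
Proof. unfold prd; red_eqs. Qed.
Lemma sub_0r a : a - c0 ==[T] a.
Proof. unfold sub; red_eqs. Qed.
Lemma sub_Sr a b : a - cSucc @ b ==[T] prd @ (a - b).
Proof. unfold sub; red_eqs. Qed.
Lemma mul_0r a : a * c0 ==[T] c0.
Proof. unfold mul; red_eqs. Qed.
Lemma mul_Sr a b : a * (cSucc @ b) ==[T] a * b + a.
Proof. unfold mul; red_eqs. Qed.
End Arith.

Lemma add_0l (G : ctx) (T : theory G) (n : term G tN) : c0 + n ==[T] n.
Proof.
induct (@holds_ind_eq G T (c0 + v0) v0 n).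
- apply add_0r.
- rewrite add_Sr, IH; reflexivity.
Qed.

Lemma add_Sl (G : ctx) (T : theory G) (a n : term G tN) : cSucc @ a + n ==[T] cSucc @ (a + n).
Proof.
induct (@holds_ind_eq G T (cSucc @ wk a + v0) (cSucc @ (wk a + v0)) n).
- rewrite !add_0r; reflexivity.
- rewrite !add_Sr, IH; reflexivity.
Qed.

Lemma add_comm (G : ctx) (T : theory G) (a n : term G tN) : a + n ==[T] n + a.
Proof.
induct (@holds_ind_eq G T (wk a + v0) (v0 + wk a) n).
- rewrite add_0r, add_0l; reflexivity.
- rewrite add_Sr, add_Sl, IH; reflexivity.
Qed.

Lemma add_assoc (G : ctx) (T : theory G) (a b n : term G tN) : a + b + n ==[T] a + (b + n).
Proof.
induct (@holds_ind_eq G T (wk a + wk b + v0) (wk a + (wk b + v0)) n).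
- rewrite !add_0r; reflexivity.
- rewrite !add_Sr, IH; reflexivity.
Qed.

Lemma sub_SS (G : ctx) (T : theory G) (a n : term G tN) : cSucc @ a - cSucc @ n ==[T] a - n.
Proof.
induct (@holds_ind_eq G T (cSucc @ wk a - cSucc @ v0) (wk a - v0) n).
- rewrite sub_Sr, !sub_0r, prd_S; reflexivity.
- rewrite sub_Sr, IH, sub_Sr; reflexivity.
Qed.

Lemma sub_0l (G : ctx) (T : theory G) (n : term G tN) : c0 - n ==[T] c0.
Proof.
induct (@holds_ind_eq G T (c0 - v0) c0 n).
- apply sub_0r.
- rewrite sub_Sr, IH; apply prd_0.
Qed.

Lemma sub_add (G : ctx) (T : theory G) (a n : term G tN) : n + a - n ==[T] a.
Proof.
induct (@holds_ind_eq G T (v0 + wk a - v0) (wk a) n).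
- rewrite add_0l; apply sub_0r.
- rewrite add_Sl, sub_SS; exact IH.
Qed.

Lemma sub_add_add (G : ctx) (T : theory G) (a b n : term G tN) : (n + a) - (n + b) ==[T] a - b.
Proof.
induct (@holds_ind_eq G T ((v0 + wk a) - (v0 + wk b)) (wk a - wk b) n).
- rewrite !add_0l; reflexivity.
- rewrite !add_Sl, sub_SS; exact IH.
Qed.

(** The induction is carried out on the formal disjunction; completeness of [T] then turns it into
    an actual case distinction. *)
Lemma zero_or_succ (G : ctx) (T : theory G) (n : term G tN) :
  n ==[T] c0 \/ n ==[T] cSucc @ (prd @ n).
Proof.
rewrite !teq_Eq, <- holds_Or.
induct (@holds_ind G T (Or (Eq v0 c0) (Eq v0 (cSucc @ (prd @ v0)))) n).
- apply holds_Or; left; apply teq_Eq; reflexivity.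
- apply holds_Or; right; apply teq_Eq; rewrite prd_S; reflexivity.
Qed.

(** * The order on the natural numbers *)

Section Order.
Context {G : ctx} (T : theory G).
Implicit Types a b c n : term G tN.

Lemma add_cancel n a b : n + a ==[T] n + b -> a ==[T] b.
Proof. intros E; rewrite <- (sub_add T a n), E; apply sub_add. Qed.

Lemma succ_neq_0 a : ~ cSucc @ a ==[T] c0.
Proof.
rewrite teq_Eq, <- holds_Neg; apply holds_der0, ax, ax_TM, ax_succ0.
Qed.

Lemma le_add a c : a <=[T] a + c.
Proof.
apply tle_teq; rewrite <- (add_0r T a) at 1; rewrite sub_add_add; apply sub_0l.
Qed.
End Order.

(** Linearity of the order, with the truncated differences as explicit witnesses. In the step, only
    the case in which [a] exceeds n needs care: the difference is zero, and the roles switch, or a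
    successor, and it drops by one. *)
Lemma sub_total (G : ctx) (T : theory G) (a n : term G tN) :
  a ==[T] n + (a - n) \/ n ==[T] a + (n - a).
Proof.
rewrite !teq_Eq, <- holds_Or.
induct (@holds_ind G T (Or (Eq (wk a) (v0 + (wk a - v0))) (Eq v0 (wk a + (v0 - wk a)))) n).
- apply holds_Or; left; apply teq_Eq; rewrite add_0l, sub_0r; reflexivity.
- rewrite holds_Or, <- !teq_Eq.
  assert (E1 : forall b n c : term (tN :: G) tN, n ==[T'] b + c ->
    cSucc @ n ==[T'] b + (cSucc @ n - b)).
  { intros b m c E1; rewrite E1, <- add_Sr, sub_add; reflexivity. }
  rewrite holds_Or, <- !teq_Eq in IH.
  destruct IH as [IH | IH]; [| right; apply E1 with (v0 - wk a); exact IH].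
  destruct (zero_or_succ T' (wk a - v0)) as [Z | Z]; rewrite Z in IH.
  + right; apply E1 with c0; rewrite add_0r, IH, add_0r; reflexivity.
  + left; rewrite add_Sr, <- add_Sl in IH; rewrite IH at 2.
    rewrite sub_add; exact IH.
Qed.

Section Linear.
Context {G : ctx} (T : theory G).
Implicit Types a b c n : term G tN.

Lemma le_iff a b : a <=[T] b <-> exists c, b ==[T] a + c.
Proof.
split; [| intros [c E]; rewrite E; apply le_add].
rewrite tle_teq; intros E; destruct (sub_total T b a) as [H | H]; [eauto |].
exists c0; rewrite H, E, !add_0r; reflexivity.
Qed.

Lemma le_or_lt a b : a <=[T] b \/ cSucc @ b <=[T] a.
Proof.
rewrite !le_iff; destruct (sub_total T b a) as [H | H]; [left; eauto |].
destruct (zero_or_succ T (a - b)) as [Z | Z]; rewrite Z in H.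
- left; exists c0; rewrite H, !add_0r; reflexivity.
- right; exists (prd @ (a - b)); rewrite H at 1; rewrite add_Sr, add_Sl; reflexivity.
Qed.

Lemma le_refl a : a <=[T] a.
Proof. apply le_iff; exists c0; rewrite add_0r; reflexivity. Qed.

Lemma le_trans a b c : a <=[T] b -> b <=[T] c -> a <=[T] c.
Proof.
rewrite !le_iff; intros [d Ed] [e Ee]; exists (d + e); rewrite Ee, Ed; apply add_assoc.
Qed.

Lemma add_add_comm a b c n : (a + b) + (c + n) ==[T] (a + c) + (b + n).
Proof.
rewrite !add_assoc, <- (add_assoc T b c n), (add_comm T b c), add_assoc; reflexivity.
Qed.

Lemma le_add_add a b c n : a <=[T] b -> c <=[T] n -> a + c <=[T] b + n.
Proof.
rewrite !le_iff; intros [d Ed] [e Ee]; exists (d + e); rewrite Ee, Ed; apply add_add_comm.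
Qed.

Lemma le_cancel n a b : n + a <=[T] n + b -> a <=[T] b.
Proof.
rewrite !le_iff; intros [c E]; exists c; apply (@add_cancel G T n); rewrite E; apply add_assoc.
Qed.

Lemma le_succ_false a : ~ cSucc @ a <=[T] a.
Proof.
rewrite le_iff; intros [c E]; apply (@succ_neq_0 G T c), (@add_cancel G T a).
rewrite add_0r, add_Sr, <- add_Sl; symmetry; exact E.
Qed.

Lemma le_antisym a b : a <=[T] b -> b <=[T] a -> a ==[T] b.
Proof.
intros H; rewrite !le_iff; intros [c E]; revert H; rewrite le_iff; intros [d Ed].
assert (Z : c + d ==[T] c0).
{ apply (@add_cancel G T b); rewrite <- add_assoc, <- E, add_0r; symmetry; exact Ed. }
destruct (zero_or_succ T c) as [Ec | Ec]; rewrite Ec in *.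
- rewrite E, add_0r; reflexivity.
- rewrite add_Sl in Z; exfalso; exact (succ_neq_0 Z).
Qed.

Lemma eq_le a b : a ==[T] b -> a <=[T] b.
Proof. intros E; rewrite E; apply le_refl. Qed.
Lemma eq_ge a b : a ==[T] b -> b <=[T] a.
Proof. intros E; rewrite E; apply le_refl. Qed.
End Linear.

(** * Linear inequalities by reflection *)

Inductive lexp : Type :=
| LV (i : nat)
| LO
| LS (e : lexp)
| LP (e1 e2 : lexp).

(** The multiset of summands of an expression; [None] stands for a unit contributed by a
    successor. *)
Fixpoint flat (e : lexp) : list (option nat) :=
  match e with
  | LV i => Some i :: nil
  | LO => nil
  | LS e => None :: flat e
  | LP e1 e2 => flat e1 ++ flat e2
  end.

Definition atom_eqb (o o' : option nat) : bool :=
  match o, o' with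
  | None, None => true
  | Some i, Some j => Nat.eqb i j
  | _, _ => false
  end.

Fixpoint extract (o : option nat) (l : list (option nat)) : option (list (option nat)) :=
  match l with
  | nil => None
  | o' :: l => if atom_eqb o o' then Some l else option_map (cons o') (extract o l)
  end.

Fixpoint submultiset (l l' : list (option nat)) : bool :=
  match l with
  | nil => true
  | o :: l => match extract o l' with None => false | Some l' => submultiset l l' end
  end.

Section Reflection.
Context {G : ctx} (T : theory G) (env : list (term G tN)).

Fixpoint den (e : lexp) : term G tN :=
  match e with
  | LV i => nth i env c0
  | LO => c0
  | LS e => cSucc @ den e
  | LP e1 e2 => den e1 + den e2
  end.

Fixpoint sum (l : list (option nat)) : term G tN :=
  match l with
  | nil => c0
  | o :: l => match o with None => cSucc @ c0 | Some i => nth i env c0 end + sum l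
  end.

Lemma sum_app l l' : sum (l ++ l') ==[T] sum l + sum l'.
Proof.
induction l as [| o l IH]; simpl.
- rewrite add_0l; reflexivity.
- rewrite IH, add_assoc; reflexivity.
Qed.

Lemma den_sum e : den e ==[T] sum (flat e).
Proof.
induction e as [i | | e IH | e1 IH1 e2 IH2]; simpl.
- rewrite add_0r; reflexivity.
- reflexivity.
- rewrite IH, add_Sl, add_0l; reflexivity.
- rewrite sum_app, IH1, IH2; reflexivity.
Qed.

Lemma extract_sum o l : forall l', extract o l = Some l' -> sum l ==[T] sum (o :: l').
Proof.
induction l as [| o' l IH]; intros l'; simpl; [discriminate |].
destruct (atom_eqb o o') eqn:E.
- intros [= <-].
  assert (o = o') as ->; [| reflexivity].
  destruct o, o'; try discriminate; [apply Nat.eqb_eq in E; congruence | reflexivity].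
- destruct (extract o l) as [l'' |]; [| discriminate]; intros [= <-].
  rewrite (IH _ eq_refl); simpl.
  rewrite <- !add_assoc, (add_comm T (match o' with None => _ | _ => _ end)); reflexivity.
Qed.

Lemma submultiset_le l : forall l', submultiset l l' = true -> sum l <=[T] sum l'.
Proof.
induction l as [| o l IH]; intros l' H; simpl in H.
- apply le_iff; exists (sum l'); rewrite add_0l; reflexivity.
- destruct (extract o l') as [l'' |] eqn:E; [| discriminate].
  rewrite (extract_sum E); apply le_add_add; [apply le_refl | auto].
Qed.

(** The multiset test gives e1 + h2 <= e2 + h1 <= e2 + h2, and h2 cancels. Coefficients other than 1
    are obtained by listing a hypothesis several times in [lin]. *)
Lemma linear_le e1 e2 h1 h2 : den h1 <=[T] den h2 ->
  submultiset (flat (LP e1 h2)) (flat (LP e2 h1)) = true -> den e1 <=[T] den e2.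
Proof.
intros H C; apply submultiset_le in C; rewrite <- !den_sum in C; simpl in C.
apply (@le_cancel G T (den h2)); rewrite (add_comm T (den h2)).
apply (le_trans C); rewrite (add_comm T (den h2)).
apply le_add_add; [apply le_refl | exact H].
Qed.

Lemma linear_false h1 h2 : den h1 <=[T] den h2 ->
  submultiset (flat (LS h2)) (flat h1) = true -> False.
Proof.
intros H C; apply submultiset_le in C; rewrite <- !den_sum in C; simpl in C.
apply (@le_succ_false G T (den h2)), (le_trans C H).
Qed.
End Reflection.

Ltac mem x l := match l with
  | nil => constr:(false) | x :: _ => constr:(true) | _ :: ?l' => mem x l' end.
Ltac index x l := match l with
  | x :: _ => constr:(O) | _ :: ?l' => let n := index x l' in constr:(S n) end.
Ltac atoms e env := match e with
  | c0 => env
  | cSucc @ ?a => atoms a env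
  | add @ ?a @ ?b => let env := atoms a env in atoms b env
  | _ => match mem e env with true => env | false => constr:(e :: env) end
  end.
Ltac reify e env := match e with
  | c0 => constr:(LO)
  | cSucc @ ?a => let a := reify a env in constr:(LS a)
  | add @ ?a @ ?b => let a := reify a env in let b := reify b env in constr:(LP a b)
  | _ => let i := index e env in constr:(LV i)
  end.

Ltac lin1 H := cbn [num] in *; match goal with
  | |- @tle ?G ?T ?a ?b => match type of H with @tle G T ?x ?y =>
      let env := atoms a (@nil (term G tN)) in let env := atoms b env in
      let env := atoms x env in let env := atoms y env in
      let a' := reify a env in let b' := reify b env in
      let x' := reify x env in let y' := reify y env in
      exact (@linear_le G T env a' b' x' y' H eq_refl) end
  | |- False => match type of H with @tle ?G ?T ?x ?y =>
      let env := atoms x (@nil (term G tN)) in let env := atoms y env in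
      let x' := reify x env in let y' := reify y env in
      exact (@linear_false G T env x' y' H eq_refl) end
  end.
(* [lin (H1, ..., Hn)]: the goal follows from the sum of the inequalities [Hi]. *)
Ltac lin_sum p := match p with
  | (?p', ?H) => let K := lin_sum p' in constr:(le_add_add K H)
  | ?H => H
  end.
Ltac lin p := let H := fresh in
  let K := lin_sum p in assert (H := K); lin1 H.

(** * Represented reals *)

Section Computation.
Context {G : ctx} (T : theory G).
Implicit Types a b c n k : term G tN.
Implicit Types f g p q : term G one.

Lemma minN_eq a b : minN @ a @ b ==[T] a - (a - b).
Proof. unfold minN; red_eqs. Qed.
Lemma toR_0 g : toR @ g @ c0 ==[T] g @ c0.
Proof. unfold toR; red_eqs. Qed.
Lemma toR_S g n : toR @ g @ (cSucc @ n) ==[T] minN @ (g @ (cSucc @ n)) @ num 2.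
Proof. unfold toR; red_eqs. Qed.
Lemma pow2_S n : pow2 @ (cSucc @ n) ==[T] pow2 @ n + pow2 @ n.
Proof. unfold pow2; red_eqs. Qed.
Lemma half_0 : half @ c0 ==[T] c0.
Proof. unfold half; red_eqs. Qed.
Lemma half_S n : half @ (cSucc @ n) ==[T] n - half @ n.
Proof. unfold half; red_eqs. Qed.
Lemma divS_0 k : divS @ c0 @ k ==[T] c0.
Proof. unfold divS; red_eqs. Qed.
Lemma divS_S n k : divS @ (cSucc @ n) @ k ==[T] divS @ n @ k +
  (num 1 - ((cSucc @ (divS @ n @ k)) * (cSucc @ k) - cSucc @ n)).
Proof. unfold divS; red_eqs. Qed.
Lemma odd_eq n : odd @ n ==[T] n - (half @ n + half @ n).
Proof. unfold odd; red_eqs. Qed.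
Lemma decP_eq n : decP @ n ==[T] half @ n * (num 1 - odd @ n).
Proof. unfold decP; red_eqs. Qed.
Lemma decN_eq n : decN @ n ==[T] half @ (cSucc @ n) * (odd @ n).
Proof. unfold decN; red_eqs. Qed.
Lemma code_eq a b : code @ a @ b ==[T] ((a - b) + (a - b)) + (((b - a) + (b - a)) - num 1).
Proof. unfold code; red_eqs. Qed.
Lemma apP_0 g : apP @ g @ c0 ==[T] decP @ (g @ c0).
Proof. rewrite <- (toR_0 g); unfold apP; red_eqs. Qed.
Lemma apP_S g n : apP @ g @ (cSucc @ n) ==[T] apP @ g @ n + apP @ g @ n + toR @ g @ (cSucc @ n).
Proof. unfold apP; red_eqs. Qed.
Lemma apN_0 g : apN @ g @ c0 ==[T] decN @ (g @ c0).
Proof. rewrite <- (toR_0 g); unfold apN; red_eqs. Qed.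
Lemma apN_S g n : apN @ g @ (cSucc @ n) ==[T] cSucc @ (apN @ g @ n + apN @ g @ n).
Proof. unfold apN; red_eqs. Qed.
Lemma ofSums_0 p q : ofSums @ p @ q @ c0 ==[T] code @ (p @ c0) @ (q @ c0).
Proof. unfold ofSums; red_eqs. Qed.
Lemma ofSums_S p q n : ofSums @ p @ q @ (cSucc @ n) ==[T]
  cSucc @ (p @ (cSucc @ n) + (q @ n + q @ n)) - (q @ (cSucc @ n) + (p @ n + p @ n)).
Proof. unfold ofSums; red_eqs. Qed.
Lemma natR_eq k : natR @ k ==[T] ofSums @ lam (wk k * (pow2 @ v0)) @ lam c0.
Proof. unfold natR; red_eqs. Qed.
Lemma invR_eq k : invR @ k ==[T] ofSums @ lam (divS @ (pow2 @ v0) @ wk k) @ lam c0.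
Proof. unfold invR; red_eqs. Qed.


(* With [S_n] the sum of the partial sums' numerators, the partial sums of [addR f g]
   have the numerators [sumP f g n - sumN f g n = floor((S_{n+2} + 2) / 4)]. *)
Definition sumN f g n : term G tN :=
  apN @ f @ (cSucc @ (cSucc @ n)) + apN @ g @ (cSucc @ (cSucc @ n)).
Definition sumQ f g n : term G tN :=
  (apP @ f @ (cSucc @ (cSucc @ n)) + apP @ g @ (cSucc @ (cSucc @ n)))
  + num 3 * sumN f g n + num 2.
Definition sumP f g n : term G tN := half @ (half @ sumQ f g n).

Lemma addR_0 f g : addR @ f @ g @ c0 ==[T] code @ sumP f g c0 @ sumN f g c0.
Proof.
unfold addR, sumP, sumQ, sumN; red_lam; rewrite ofSums_0; red_lam; reflexivity.
Qed.

Lemma addR_S f g n : addR @ f @ g @ (cSucc @ n) ==[T]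
  cSucc @ (sumP f g (cSucc @ n) + (sumN f g n + sumN f g n))
    - (sumN f g (cSucc @ n) + (sumP f g n + sumP f g n)).
Proof.
unfold addR, sumP, sumQ, sumN; red_lam; rewrite ofSums_S; red_lam; reflexivity.
Qed.
End Computation.

(** * Products, truncated subtraction and halving *)

Lemma mul_Sl (G : ctx) (T : theory G) (a n : term G tN) : (cSucc @ a) * n ==[T] a * n + n.
Proof.
induct (@holds_ind_eq G T (cSucc @ wk a * v0) (wk a * v0 + v0) n).
- rewrite !mul_0r, add_0r; reflexivity.
- rewrite !mul_Sr, IH, !add_Sr, !add_assoc, (add_comm _ (wk a)); reflexivity.
Qed.

Lemma mul_0l (G : ctx) (T : theory G) (n : term G tN) : c0 * n ==[T] c0.
Proof.
induct (@holds_ind_eq G T (c0 * v0) c0 n).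
- rewrite !mul_0r; reflexivity.
- rewrite !mul_Sr, IH, add_0r; reflexivity.
Qed.

Section Subtraction.
Context {G : ctx} (T : theory G).
Implicit Types a b c n : term G tN.

Lemma sub_eq a b c : a ==[T] b + c -> a - b ==[T] c.
Proof. intros E; rewrite E; apply sub_add. Qed.

Lemma sub_diag a : a - a ==[T] c0.
Proof. apply sub_eq; rewrite add_0r; reflexivity. Qed.

Lemma sub_le a b c : a - c <=[T] b <-> a <=[T] c + b.
Proof.
destruct (sub_total T a c) as [E | E].
- split; intros H.
  + rewrite E; lin (H).
  + rewrite E in H; apply (@le_cancel G T c); exact H.
- assert (Z : a - c ==[T] c0) by (apply tle_teq; rewrite E; apply le_add).
  rewrite Z; split; intros _.
  + assert (H : a <=[T] c) by (apply tle_teq; exact Z); lin H.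
  + assert (H := le_refl T c0); lin H.
Qed.

Lemma sub_le_self a b : a - b <=[T] a.
Proof. apply sub_le; assert (H := le_refl T c0); lin H. Qed.

Lemma mul_1r a : a * num 1 ==[T] a.
Proof. cbn [num]; rewrite mul_Sr, mul_0r; apply add_0l. Qed.

Lemma mul3 a : num 3 * a ==[T] a + a + a.
Proof. cbn [num]; rewrite !mul_Sl, mul_0l, add_0l; reflexivity. Qed.

Lemma minN_le_l a b : minN @ a @ b <=[T] a.
Proof. rewrite minN_eq; apply sub_le_self. Qed.

Lemma minN_le_r a b : minN @ a @ b <=[T] b.
Proof.
rewrite minN_eq; apply sub_le.
assert (H := le_refl T (a - b)); apply sub_le in H; lin H.
Qed.
End Subtraction.

Ltac lineq := apply le_antisym;
  match goal with |- @tle _ ?T _ _ => lin (le_refl T c0) end.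

Lemma half_double (G : ctx) (T : theory G) (n : term G tN) : half @ (n + n) ==[T] n.
Proof.
induct (@holds_ind_eq G T (half @ (v0 + v0)) v0 n).
- rewrite add_0r; apply half_0.
- rewrite add_Sl, add_Sr, !half_S, IH.
  apply sub_eq; rewrite (@sub_eq _ _ _ _ v0) by reflexivity; lineq.
Qed.

Lemma half_spec (G : ctx) (T : theory G) (n : term G tN) :
  n ==[T] half @ n + half @ n \/ n ==[T] cSucc @ (half @ n + half @ n).
Proof.
rewrite !teq_Eq, <- holds_Or.
induct (@holds_ind G T (Or (Eq v0 (half @ v0 + half @ v0))
  (Eq v0 (cSucc @ (half @ v0 + half @ v0)))) n).
- apply holds_Or; left; apply teq_Eq; rewrite half_0, add_0r; reflexivity.
- rewrite holds_Or, <- !teq_Eq in IH |- *; rewrite !half_S.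
  destruct IH as [IH | IH].
  + right; rewrite (sub_eq IH); rewrite IH at 1; reflexivity.
  + left; rewrite (@sub_eq _ T' v0 (half @ v0) (cSucc @ (half @ v0))) by
      (rewrite add_Sr; exact IH).
    rewrite IH at 1; lineq.
Qed.

(** * Partial sums of represented reals *)

Section Bounds.
Context {G : ctx} (T : theory G).
Implicit Types a b c n m p q : term G tN.
Implicit Types f g : term G one.

(** Decoding returns a - b, written without negative numbers. If a = b + c the code is the even
    number 2c; if b = a + d + 1 it is 2d + 1, which stands for -(d + 1). *)
Lemma dec_code a b : decP @ (code @ a @ b) + b ==[T] a + decN @ (code @ a @ b).
Proof.
assert (H0 : forall c, a ==[T] b + c ->
  decP @ (code @ a @ b) + b ==[T] a + decN @ (code @ a @ b)).
{ intros c E.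
  assert (C : code @ a @ b ==[T] c + c).
  { assert (Z : b - a ==[T] c0) by (apply tle_teq; rewrite E; apply le_add).
    rewrite code_eq, Z, (sub_eq E), add_0r; cbn [num]; rewrite sub_0l; apply add_0r. }
  assert (O : odd @ (c + c) ==[T] c0) by (rewrite odd_eq, half_double; apply sub_diag).
  rewrite C, decP_eq, decN_eq, O, half_double, sub_0r, mul_1r, mul_0r, E; lineq. }
destruct (sub_total T a b) as [E | E]; [exact (H0 _ E) |].
destruct (zero_or_succ T (b - a)) as [Z | Z]; rewrite Z in E.
- apply (H0 c0); rewrite add_0r; rewrite add_0r in E; symmetry; exact E.
- set (d := prd @ (b - a)) in *.
  assert (C : code @ a @ b ==[T] cSucc @ (d + d)).
  { assert (Z' : a - b ==[T] c0) by (apply tle_teq; rewrite E; apply le_add).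
    rewrite code_eq, Z', (sub_eq E), !add_0l; apply sub_eq; lineq. }
  assert (HD : half @ (cSucc @ (d + d)) ==[T] d).
  { rewrite half_S, half_double; apply sub_eq; reflexivity. }
  assert (O : odd @ (cSucc @ (d + d)) ==[T] num 1).
  { rewrite odd_eq, HD; apply sub_eq; lineq. }
  assert (HD' : half @ (cSucc @ (cSucc @ (d + d))) ==[T] cSucc @ d).
  { rewrite <- (half_double T (cSucc @ d)), add_Sl, add_Sr; reflexivity. }
  rewrite C, decP_eq, decN_eq, O, HD, HD', mul_1r, sub_diag, mul_0r, E; lineq.
Qed.

Lemma apP_S_le_digit f n : apP @ f @ (cSucc @ n) <=[T] apP @ f @ n + apP @ f @ n + f @ (cSucc @ n).
Proof. rewrite apP_S, toR_S; lin (minN_le_l T (f @ (cSucc @ n)) (num 2)). Qed.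

Lemma apP_S_le f n : apP @ f @ (cSucc @ n) <=[T] apP @ f @ n + apP @ f @ n + num 2.
Proof. rewrite apP_S, toR_S; lin (minN_le_r T (f @ (cSucc @ n)) (num 2)). Qed.

Lemma apP_S_ge f n : apP @ f @ n + apP @ f @ n <=[T] apP @ f @ (cSucc @ n).
Proof. rewrite apP_S; apply le_add. Qed.

(** With P = p - q and P' = p' - q', the entry is the truncation at 0 of 1 + P' - 2P. If nothing is
    truncated there, A_n <= P gives A_{n+1} <= 2P + (P' - 2P) = P'. The cut of the entry to at most
    2 only lowers A_{n+1}, so an upper estimate needs only the lower bound on the digit. *)
Lemma partial_sum_step f n p p' q q' :
  f @ (cSucc @ n) ==[T] cSucc @ (p' + (q + q)) - (q' + (p + p)) ->
  q' + (p + p) <=[T] cSucc @ (p' + (q + q)) ->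
  apP @ f @ n + q <=[T] p + apN @ f @ n ->
  apP @ f @ (cSucc @ n) + q' <=[T] p' + apN @ f @ (cSucc @ n).
Proof.
intros E Hd IH; apply tle_teq in Hd.
destruct (sub_total T (cSucc @ (p' + (q + q))) (q' + (p + p))) as [X | X].
- rewrite <- E in X; rewrite apN_S.
  lin (apP_S_le_digit f n, IH, IH, eq_ge X).
- rewrite Hd, add_0r in X.
  assert (E0 : f @ (cSucc @ n) ==[T] c0) by (rewrite E, X; apply sub_diag).
  assert (D := apP_S_le_digit f n); rewrite E0 in D; rewrite apN_S.
  lin (D, IH, IH, eq_le X).
Qed.

(** The entry 1 codes the digit 0, so both numerators pass from A to 2A + 1. *)
Lemma zero_digit f n : f @ (cSucc @ n) ==[T] num 1 -> apP @ f @ n ==[T] apN @ f @ n ->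
  apP @ f @ (cSucc @ n) ==[T] apN @ f @ (cSucc @ n).
Proof.
intros D IH; rewrite apP_S, apN_S, toR_S, D, IH, minN_eq; cbn [num].
rewrite sub_SS, sub_0l, sub_0r; lineq.
Qed.

Lemma zero_head f : f @ c0 ==[T] code @ c0 @ c0 -> apP @ f @ c0 ==[T] apN @ f @ c0.
Proof.
intros E; rewrite apP_0, apN_0, E, <- (add_0r T (decP @ _)), dec_code; apply add_0l.
Qed.
End Bounds.

Ltac to_tle := repeat match goal with
  | |- holds ?T (Eq (?a - ?b) c0) => change (tle T a b)
  | |- holds ?T (le0 ?a ?b) => change (tle T a b)
  | H : holds ?T (Eq (?a - ?b) c0) |- _ => change (tle T a b) in H
  | H : holds ?T (le0 ?a ?b) |- _ => change (tle T a b) in H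
  end.

Lemma apP_natR0 (G : ctx) (T : theory G) (n : term G tN) :
  apP @ (natR @ num 0) @ n ==[T] apN @ (natR @ num 0) @ n.
Proof.
induct (@holds_ind_eq G T (apP @ (natR @ num 0) @ v0) (apN @ (natR @ num 0) @ v0) n).
- apply zero_head; cbn [num]; rewrite natR_eq, ofSums_0, !beta; sbst.
  rewrite mul_0l; reflexivity.
- apply zero_digit; [| exact IH].
  cbn [num]; rewrite natR_eq, ofSums_S, !beta; sbst.
  rewrite !mul_0l, !add_0r, sub_0r; reflexivity.
Qed.

Lemma pow2_mono (G : ctx) (T : theory G) (a n : term G tN) : pow2 @ a <=[T] pow2 @ (a + n).
Proof.
induct (@holds_ind G T (le0 (pow2 @ wk a) (pow2 @ (wk a + v0))) n).
- to_tle; rewrite add_0r; apply le_refl.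
- to_tle; rewrite add_Sr, pow2_S; apply (le_trans IH), le_add.
Qed.

Lemma divS_small (G : ctx) (T : theory G) (k n : term G tN) :
  n <=[T] k -> divS @ n @ k ==[T] c0.
Proof.
rewrite teq_Eq; apply holds_Imp.
induct (@holds_ind G T (Imp (le0 v0 (wk k)) (Eq (divS @ v0 @ wk k) c0)) n).
- apply holds_Imp; intros _; apply teq_Eq, divS_0.
- apply holds_Imp; intros L; to_tle.
  rewrite holds_Imp, <- teq_Eq in IH; rewrite <- teq_Eq.
  assert (Z : divS @ v0 @ wk k ==[T'] c0) by (apply IH; to_tle; lin L).
  (* With quotient 0 so far, the increment is 1 - (k - n), which is zero because n + 1 <= k makes k
     - n positive. *)
  rewrite divS_S, Z, add_0l, mul_Sl, mul_0l, add_0l, sub_SS.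
  apply le_iff in L; destruct L as [c ->].
  rewrite (@sub_eq _ T' _ v0 (cSucc @ c)) by lineq.
  cbn [num]; rewrite sub_SS; apply sub_0l.
Qed.

(* [1 / (2^N + 1)] has only zero digits up to the [N]-th. *)
Lemma apP_invR (G : ctx) (T : theory G) (N n : term G tN) : n <=[T] N ->
  apP @ (invR @ (pow2 @ N)) @ n ==[T] apN @ (invR @ (pow2 @ N)) @ n.
Proof.
rewrite teq_Eq; apply holds_Imp.
assert (small : forall (G : ctx) (T : theory G) (N n : term G tN), n <=[T] N ->
  divS @ (pow2 @ n) @ (pow2 @ N) ==[T] c0).
{ intros G' T' N' n' L; apply le_iff in L; destruct L as [c ->].
  apply divS_small, pow2_mono. }
induct (@holds_ind G T (Imp (le0 v0 (wk N)) (Eq (apP @ (invR @ (pow2 @ wk N)) @ v0)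
  (apN @ (invR @ (pow2 @ wk N)) @ v0))) n).
- apply holds_Imp; intros L; apply teq_Eq, zero_head; rewrite invR_eq, ofSums_0, !beta; sbst.
  rewrite small; [reflexivity | exact L].
- apply holds_Imp; intros L; to_tle.
  assert (L' : v0 <=[T'] wk N) by lin L.
  rewrite holds_Imp, <- teq_Eq in IH; rewrite <- teq_Eq.
  apply zero_digit; [| exact (IH L')].
  rewrite invR_eq, ofSums_S, !beta; sbst.
  rewrite !small by assumption; rewrite !add_0r, sub_0r; reflexivity.
Qed.

(** * Rounding in the sum of two reals *)

Section Rounding.
Context {G : ctx} (T : theory G).
Implicit Types n : term G tN.
Implicit Types f g : term G one.

Lemma half_bounds (a : term G tN) :
  half @ a + half @ a <=[T] a /\ a <=[T] cSucc @ (half @ a + half @ a).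
Proof.
destruct (half_spec T a) as [E | E]; split; first [lin (eq_le E) | lin (eq_ge E)].
Qed.

Lemma quarter_bounds (a h : term G tN) : h = half @ (half @ a) ->
  h + h + (h + h) <=[T] a /\ a <=[T] h + h + (h + h) + num 3.
Proof.
intros ->; destruct (half_bounds a) as [L U], (half_bounds (half @ a)) as [L' U'].
split; [lin (L, L', L') | lin (U, U', U')].
Qed.

(** This is E_{n+1} >= 2 E_n - 1 for E = [sumP] - [sumN]. Two digits are each at least -1, so
    S_{n+3} >= 2 S_{n+2} - 2; the rounding gives 4 E_n <= S_{n+2} + 2 and 4 E_{n+1} >= S_{n+3} - 1.
    Hence 4 E_{n+1} >= 8 E_n - 7, and integrality does the rest. *)
Lemma sumP_double f g n :
  cSucc @ (sumP f g n + sumP f g n) <=[T] sumP f g (cSucc @ n).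
Proof.
destruct (@quarter_bounds (sumQ f g n) (sumP f g n) eq_refl) as [L _].
destruct (@quarter_bounds (sumQ f g (cSucc @ n)) (sumP f g (cSucc @ n)) eq_refl) as [_ U].
destruct (le_or_lt T (cSucc @ (sumP f g n + sumP f g n)) (sumP f g (cSucc @ n)))
  as [| H]; [assumption | exfalso].
unfold sumQ, sumN in L, U; rewrite mul3 in L, U; rewrite !(apN_S T) in U.
assert (F := apP_S_ge T f (cSucc @ (cSucc @ n))).
assert (F' := apP_S_ge T g (cSucc @ (cSucc @ n))).
rewrite !(apN_S T f), !(apN_S T g) in L.
lin (L, L, U, F, F', H, H, H, H).
Qed.
End Rounding.

Lemma sumN_S (G : ctx) (T : theory G) (f g : term G one) (n : term G tN) :
  sumN f g (cSucc @ n) ==[T] cSucc @ (cSucc @ (sumN f g n + sumN f g n)).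
Proof. unfold sumN; rewrite !(apN_S T _ (cSucc @ (cSucc @ n))); lineq. Qed.

(** An upper estimate suffices, as the sum stands on the larger side of the triangle inequality. *)
Lemma addR_upper (G : ctx) (T : theory G) (f g : term G one) (n : term G tN) :
  apP @ (addR @ f @ g) @ n + sumN f g n <=[T] sumP f g n + apN @ (addR @ f @ g) @ n.
Proof.
induct (@holds_ind G T (le0
  (apP @ (addR @ wk f @ wk g) @ v0 + sumN (wk f) (wk g) v0)
  (sumP (wk f) (wk g) v0 + apN @ (addR @ wk f @ wk g) @ v0)) n);
  unfold sumP, sumQ, sumN; sbst.
- to_tle; rewrite apP_0, apN_0, addR_0; apply eq_le, dec_code.
- to_tle; refine (@partial_sum_step _ T' (addR @ wk f @ wk g) v0 (sumP (wk f) (wk g) v0)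
    (sumP (wk f) (wk g) (cSucc @ v0)) (sumN (wk f) (wk g) v0)
    (sumN (wk f) (wk g) (cSucc @ v0)) _ _ IH).
  + apply addR_S.
  + rewrite sumN_S; lin (sumP_double T' (wk f) (wk g) v0).
- exact (fun X => X).
Qed.

(** * Distances at a fixed precision *)

Section Metric.
Context {G : ctx} (T : theory G).
Implicit Types n : term G tN.
Implicit Types f g : term G one.

Lemma leR_elim f g n : T (leR f g) ->
  apP @ f @ n + apN @ g @ n <=[T] (apP @ g @ n + apN @ f @ n) + num 2.
Proof. intros H; apply (holds_allE n) in H; revert H; sbst; exact (fun H => H). Qed.

Lemma eqR_elim f g n : T (eqR f g) ->
  apP @ f @ n + apN @ g @ n <=[T] (apP @ g @ n + apN @ f @ n) + num 2 /\
  apP @ g @ n + apN @ f @ n <=[T] (apP @ f @ n + apN @ g @ n) + num 2.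
Proof.
intros H; apply (holds_allE n) in H; revert H; sbst; rewrite holds_And; exact (fun H => H).
Qed.

(* A difference below [-2] at [n] would grow below [-10] at [n + 3]. *)
Lemma dist_nonneg (x y : term G tX) n :
  apN @ (cd @ x @ y) @ n <=[T] apP @ (cd @ x @ y) @ n + num 2.
Proof.
(* At precision m, -2 <= d(x,x) and d(x,x) <= sum + 2 bound the rounded sum E_m below by -4. Since 4
   E_m <= S_{m+2} + 2, the two distances have numerators adding up to at least -18 at m + 2;
   symmetry up to 2 leaves -10 for each numerator of [d(x,y)]. *)
assert (bound : forall m, apN @ (cd @ x @ y) @ (cSucc @ (cSucc @ m))
  <=[T] apP @ (cd @ x @ y) @ (cSucc @ (cSucc @ m)) + num 10).
{ intros m.
  assert (Hxx : T (eqR (cd @ x @ x) (natR @ num 0))) by apply holds_der0, ax, ax_TM, ax_dxx.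
  assert (Hsym : T (eqR (cd @ x @ y) (cd @ y @ x))) by apply holds_der0, ax, ax_TM, ax_dsym.
  assert (Htri : T (leR (cd @ x @ x) (addR @ (cd @ x @ y) @ (cd @ y @ x))))
    by apply holds_der0, ax, ax_TM, ax_dtri.
  apply (eqR_elim m) in Hxx; destruct Hxx as [_ Hxx].
  rewrite apP_natR0 in Hxx.
  apply (leR_elim m) in Htri.
  apply (eqR_elim (cSucc @ (cSucc @ m))) in Hsym; destruct Hsym as [_ Hsym].
  assert (U := addR_upper T (cd @ x @ y) (cd @ y @ x) m).
  destruct (@quarter_bounds G T (sumQ (cd @ x @ y) (cd @ y @ x) m) _ eq_refl) as [L _].
  fold (sumP (cd @ x @ y) (cd @ y @ x) m) in L.
  unfold sumQ in L; rewrite mul3 in L; unfold sumN in *.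
  destruct (le_or_lt T (apN @ (cd @ x @ y) @ (cSucc @ (cSucc @ m)))
    (apP @ (cd @ x @ y) @ (cSucc @ (cSucc @ m)) + num 10)) as [| H]; [assumption | exfalso].
  lin (Hxx, Hxx, Hxx, Hxx, Htri, Htri, Htri, Htri, U, U, U, U, L, Hsym, H, H). }
destruct (le_or_lt T (apN @ (cd @ x @ y) @ n) (apP @ (cd @ x @ y) @ n + num 2))
  as [| H]; [assumption | exfalso].
(* Digits are at most 1, so a numerator of at most -3 at n becomes at most -5, -9, -17. Two steps
   would stop at -9, which does not contradict the bound -10. *)
assert (B := bound (cSucc @ n)).
set (f := cd @ x @ y) in *.
assert (D1 := apP_S_le T f n).
assert (D2 := apP_S_le T f (cSucc @ n)).
assert (D3 := apP_S_le T f (cSucc @ (cSucc @ n))).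
rewrite !apN_S in B.
lin (B, D3, D2, D2, D1, D1, D1, D1, H, H, H, H, H, H, H, H).
Qed.

(** Up to N the bounding real has numerator 0, so the hypothesis is already one inequality of the
    equation with 0; [dist_nonneg] supplies the other at the same precision, with no loss. *)
Lemma dist_lt_inv (x y : term G tX) (N n : term G tN) :
  T (leR (cd @ x @ y) (invR @ (pow2 @ N))) -> n <=[T] N ->
  apP @ (cd @ x @ y) @ n + apN @ (natR @ num 0) @ n
    <=[T] (apP @ (natR @ num 0) @ n + apN @ (cd @ x @ y) @ n) + num 2 /\
  apP @ (natR @ num 0) @ n + apN @ (cd @ x @ y) @ n
    <=[T] (apP @ (cd @ x @ y) @ n + apN @ (natR @ num 0) @ n) + num 2.
Proof.
intros H L; apply (leR_elim n) in H; rewrite (apP_invR L) in H.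
rewrite (apP_natR0 T n); split; [lin H | lin (dist_nonneg x y n)].
Qed.
End Metric.

(** * Truth of formulas under a pending substitution *)

Lemma fren_bigAnd (G D : ctx) (f : renaming G D) l (A : Fin.t l -> form G) :
  fren f (bigAnd A) = bigAnd (fun i => fren f (A i)).
Proof. induction l as [| l IH]; simpl; [| rewrite IH]; reflexivity. Qed.

Lemma fsubst_bigAnd (G D : ctx) (f : substitution G D) l (A : Fin.t l -> form G) :
  fsubst f (bigAnd A) = bigAnd (fun i => fsubst f (A i)).
Proof. induction l as [| l IH]; simpl; [| rewrite IH]; reflexivity. Qed.

Lemma bigAnd_ext (G : ctx) l (A B : Fin.t l -> form G) :
  (forall i, A i = B i) -> bigAnd A = bigAnd B.
Proof.
induction l as [| l IH]; intros E; simpl; [reflexivity |].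
rewrite E; f_equal; apply IH; auto.
Qed.

Section Environments.
Context {G D : ctx} (T : theory D) (f : substitution G D).

Lemma fsubst_le0 a b : fsubst f (le0 a b) = le0 (subst f a) (subst f b).
Proof. unfold le0; cbn [fsubst subst]; rewrite subst_sub; reflexivity. Qed.

Lemma fsubst_Imp A B : fsubst f (Imp A B) = Imp (fsubst f A) (fsubst f B).
Proof. reflexivity. Qed.
Lemma fsubst_All s (A : form (s :: G)) : fsubst f (All s A) = All s (fsubst (ups f) A).
Proof. reflexivity. Qed.
Lemma fsubst_Ex s (A : form (s :: G)) : fsubst f (Ex s A) = Ex s (fsubst (ups f) A).
Proof. reflexivity. Qed.

Lemma holds_fsubst_Imp A B :
  T (fsubst f (Imp A B)) <-> (T (fsubst f A) -> T (fsubst f B)).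
Proof. apply holds_Imp. Qed.

Lemma holds_fsubst_All s (A : form (s :: G)) :
  T (fsubst f (All s A)) <-> forall T', ext T T' -> T' (fsubst (ups f) A).
Proof. apply holds_All. Qed.

Lemma holds_fsubst_Ex s (A : form (s :: G)) :
  T (fsubst f (Ex s A)) <-> exists T', ext T T' /\ T' (fsubst (ups f) A).
Proof. apply holds_Ex. Qed.

Lemma holds_fsubst_And A B : T (fsubst f (And A B)) <-> T (fsubst f A) /\ T (fsubst f B).
Proof. apply holds_And. Qed.

Lemma fsubst_ups_fwk s (A : form G) : fsubst (ups (s := s) f) (fwk A) = fwk (fsubst f A).
Proof.
unfold fwk; rewrite !fren_fsubst, !fsubst_fsubst; apply fsubst_ext; intros t v.
apply wk_subst.
Qed.

(** Instantiating a quantifier merely extends the pending substitution, which thus acts as an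
    environment and need not be pushed through the formula. *)
Lemma finst_ups s (A : form (s :: G)) (a : term D s) :
  finst (fsubst (ups f) A) a = fsubst (scons a f) A.
Proof.
unfold finst; rewrite fsubst_fsubst; apply fsubst_ext.
apply var_split; [reflexivity | intros t v; unfold scomp; simpl].
rewrite subst_scons_wk; apply subst_ids.
Qed.

Lemma holds_fsubst_allE s (A : form (s :: G)) a :
  T (fsubst f (All s A)) -> T (fsubst (scons a f) A).
Proof. rewrite <- finst_ups; apply holds_allE. Qed.

Lemma holds_fsubst_exI s (A : form (s :: G)) a :
  T (fsubst (scons a f) A) -> T (fsubst f (Ex s A)).
Proof. rewrite <- finst_ups; apply holds_exI. Qed.
End Environments.

Lemma fwk_fsubst (G : ctx) s (A : form G) : fwk (s := s) A = fsubst (rsub (@shift G s)) A.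
Proof. apply fren_fsubst. Qed.

(** * Ultimately *)

(** The renaming keeps the index m as variable 0 and skips the threshold. *)
Definition ultimately (G : ctx) (A : form (tN :: G)) : form G :=
  Ex tN (All tN (Imp (le0 v1 v0) (fren (upr (@shift G tN)) A))).


Section Ultimately.
Context {G : ctx}.
Implicit Types A B : form (tN :: G).

Lemma ultimately_mono (T : theory G) A B :
  T (All tN (Imp A B)) -> T (ultimately A) -> T (ultimately B).
Proof.
unfold ultimately; intros HAB HA; rewrite holds_Ex in HA |- *.
destruct HA as [T1 [E1 HA]]; exists T1; split; [exact E1 |].
rewrite holds_All in HA |- *; intros T2 E2.
specialize (HA T2 E2); rewrite holds_Imp in HA |- *; intros L.
apply E1, E2, (holds_allE v0) in HAB; specialize (HA L); revert HAB HA.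
unfold finst, fwk; cbn [fren fsubst]; rewrite holds_Imp.
assert (X : forall C : form (tN :: G), fsubst (scons v0 (@ids (tN :: tN :: G)))
    (fren (upr (@shift (tN :: G) tN)) (fren (upr (@shift G tN)) C))
    = fren (upr (@shift G tN)) C).
{ intros C; rewrite !fren_fsubst, !fsubst_fsubst; apply fsubst_ext.
  apply var_split; reflexivity. }
rewrite !X; auto.
Qed.

Lemma ultimately_and (T : theory G) A B :
  T (ultimately A) -> T (ultimately B) -> T (ultimately (And A B)).
Proof.
unfold ultimately; intros HA HB; rewrite holds_Ex in HA; destruct HA as [T1 [E1 HA]].
apply E1 in HB; change (T1 (Ex tN (fren (upr (@shift G tN)) (All tN (Imp (le0 v1 v0)
  (fren (upr (@shift G tN)) B)))))) in HB.
rewrite holds_Ex in HB; destruct HB as [T2 [E2 HB]].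
apply E2 in HA; apply E1, E2.
(* [v1] and [v0] are the thresholds of the two formulas; their sum bounds both. *)
rewrite !fwk_fsubst, fsubst_fsubst; apply holds_fsubst_exI with (v1 + v0).
apply holds_fsubst_All; intros T3 E3.
apply E3 in HA; apply E3 in HB.
rewrite fwk_fsubst, fwk_fsubst, fsubst_fsubst in HA.
rewrite fwk_fsubst, fren_fsubst, fsubst_fsubst in HB.
apply (holds_fsubst_allE v0) in HA; apply (holds_fsubst_allE v0) in HB.
revert HA HB; rewrite !holds_fsubst_Imp, !fsubst_le0; intros HA HB L.
assert (X : forall (C : form (tN :: G)) (f : substitution (tN :: tN :: G) (tN :: tN :: tN :: G)),
  f tN vz = v0 -> (forall t v, f t (vs (vs v)) = Var (vs (vs (vs v)))) ->
  fsubst f (fren (upr (@shift G tN)) C)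
  = fsubst (scons v0 (fun t (v : var G t) => Var (vs (vs (vs v))))) C).
{ intros C f H0 HS; rewrite fren_fsubst, fsubst_fsubst; apply fsubst_ext.
  apply var_split; [exact H0 | exact HS]. }
rewrite X in HA, HB |- * by reflexivity.
change (T3 (And (fsubst (scons v0 (fun t (v : var G t) => Var (vs (vs (vs v))))) A)
  (fsubst (scons v0 (fun t (v : var G t) => Var (vs (vs (vs v))))) B))).
change (tle T3 (wk (v1 + v0)) v0) in L; rewrite wk_subst in L.
change (tle T3 (v2 + v1) v0) in L.
apply holds_And; split; [apply HA | apply HB].
- change (tle T3 v2 v0); apply le_trans with (v2 + v1); [apply le_add | exact L].
- change (tle T3 v1 v0); apply le_trans with (v2 + v1); [| exact L].
  rewrite (add_comm T3 v2); apply le_add.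
Qed.

Lemma ultimately_bigAnd (T : theory G) l (A : Fin.t l -> form (tN :: G)) :
  (forall i, T (ultimately (A i))) -> T (ultimately (bigAnd A)).
Proof.
induction l as [| l IH]; intros H; simpl.
- unfold ultimately; apply holds_exI with c0; apply holds_All; intros T1 E1.
  apply holds_Imp; intros _; apply holds_Imp; auto.
- apply ultimately_and; auto.
Qed.
End Ultimately.

(** * Collection over the space *)

Lemma bounded_qf (G : ctx) (A : form G) : qf A -> bounded A.
Proof. induction 1; constructor; assumption. Qed.

Lemma qf_bigAnd (G : ctx) l (A : Fin.t l -> form G) : (forall i, qf (A i)) -> qf (bigAnd A).
Proof.
induction l as [| l IH]; intros H; simpl.
- apply qf_imp; apply qf_bot.
- apply qf_and; auto.
Qed.

Lemma qf_fren (G : ctx) (A : form G) : qf A -> forall D (f : renaming G D), qf (fren f A).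
Proof. induction 1; intros D f; simpl; constructor; auto. Qed.

Lemma holds_Ex_fwk (G : ctx) (T : theory G) s (A : form G) (a : term G s) :
  T (Ex s (fwk A)) <-> T A.
Proof.
split.
- rewrite holds_Ex; intros [T' [E HA]]; apply E, HA.
- intros HA; apply holds_exI with a; rewrite finst_fwk; exact HA.
Qed.

(* The axiom is stated for Sigma formulas; a bounded one is made so by a dummy quantifier. *)
Lemma collection_X (G : ctx) (T : theory G) (A : form (tN :: tX :: G)) : qf A ->
  T (All tX (Ex tN A)) ->
  exists T1 : theory (tN :: G), ext T T1 /\
  forall s (T2 : theory (s :: tN :: G)) (y : term (s :: tN :: G) tX), ext T1 T2 ->
  exists T3 : theory (tN :: s :: tN :: G), ext T2 T3 /\ v0 <=[T3] v2 /\
    T3 (fsubst (scons v0 (scons (wk y) (fun t v => Var (vs (vs (vs v)))))) A).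
Proof.
intros qA HA.
assert (HB : T (All tX (Ex tN (Ex tN (fwk A))))).
{ rewrite holds_All in HA |- *; intros T1 E1; specialize (HA T1 E1).
  rewrite holds_Ex in HA |- *; destruct HA as [T2 [E2 HA]].
  exists T2; split; [exact E2 |]; apply (holds_Ex_fwk T2 A c0), HA. }
assert (C : T (Imp (All tX (Ex tN (Ex tN (fwk A))))
  (Ex tN (All tX (ExLe v1 (skip2 tN (Ex tN (fwk A)))))))).
{ apply holds_der0, ax, ax_coll_X, sigma_ex, bounded_qf, qf_fren, qA. }
rewrite holds_Imp in C; apply C in HB; clear C.
rewrite holds_Ex in HB; destruct HB as [T1 [E1 HB]]; exists T1; split; [exact E1 |].
intros s T2 y E2; apply E2 in HB; rewrite fwk_fsubst in HB.
apply (holds_fsubst_allE y) in HB; unfold ExLe in HB.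
rewrite holds_fsubst_Ex in HB; destruct HB as [T3 [E3 HB]]; exists T3; split; [exact E3 |].
rewrite holds_fsubst_And, fsubst_le0 in HB; destruct HB as [L HB]; split; [exact L |].
revert HB; unfold skip2; rewrite fren_fsubst, fsubst_fsubst.
change (fsubst ?f (Ex tN (fwk A))) with (Ex tN (fsubst (ups (s := tN) f) (fwk A))).
rewrite fsubst_ups_fwk, (holds_Ex_fwk T3 _ c0); intros HB.
erewrite fsubst_ext; [exact HB |].
apply var_split; [reflexivity | apply var_split; reflexivity].
Qed.

(** * Limits of almost minimizers *)

(* The bodies of [eqR] and [ltR] at the precision [n]. *)
Definition eq_at (G : ctx) (f g : term G one) (n : term G tN) : form G :=
  And (le0 (apP @ f @ n + apN @ g @ n) ((apP @ g @ n + apN @ f @ n) + num 2))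
      (le0 (apP @ g @ n + apN @ f @ n) ((apP @ f @ n + apN @ g @ n) + num 2)).
Definition lt_at (G : ctx) (f g : term G one) (n : term G tN) : form G :=
  le0 (cSucc @ ((apP @ f @ n + apN @ g @ n) + num 2)) (apP @ g @ n + apN @ f @ n).

Lemma fsubst_eq_at (G D : ctx) (h : substitution G D) f g n :
  fsubst h (eq_at f g n) = eq_at (subst h f) (subst h g) (subst h n).
Proof.
unfold eq_at; cbn [fsubst]; rewrite !fsubst_le0; cbn [subst num].
rewrite !subst_add, !subst_apP, !subst_apN; reflexivity.
Qed.

Lemma fsubst_lt_at (G D : ctx) (h : substitution G D) f g n :
  fsubst h (lt_at f g n) = lt_at (subst h f) (subst h g) (subst h n).
Proof.
unfold lt_at; rewrite !fsubst_le0; cbn [subst num].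
rewrite !subst_add, !subst_apP, !subst_apN; reflexivity.
Qed.

Lemma fsubst_leR (G D : ctx) (h : substitution G D) a b :
  fsubst h (leR a b) = leR (subst h a) (subst h b).
Proof.
unfold leR; rewrite fsubst_All, fsubst_le0; cbn [subst num].
rewrite !subst_add, !subst_apP, !subst_apN, !subst_ups_wk; reflexivity.
Qed.

Lemma fsubst_ltR (G D : ctx) (h : substitution G D) a b :
  fsubst h (ltR a b) = ltR (subst h a) (subst h b).
Proof.
change (ltR a b) with (Ex tN (lt_at (wk a) (wk b) v0)).
rewrite fsubst_Ex, fsubst_lt_at, !subst_ups_wk; reflexivity.
Qed.

Lemma fwk_ultimately (G : ctx) s (A : form (tN :: G)) :
  fwk (s := s) (ultimately A) = ultimately (fren (upr (@shift G s)) A).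
Proof.
unfold ultimately; rewrite fwk_fsubst, fsubst_Ex, fsubst_All, fsubst_Imp, fsubst_le0.
rewrite !fren_fsubst, !fsubst_fsubst; do 3 f_equal.
apply fsubst_ext; apply var_split; reflexivity.
Qed.

Lemma asymptotic_ultimately (G : ctx) (T : theory G) U u (r : term G tN) :
  T (asymptotic U u) ->
  T (ultimately (leR (cd @ (wk U @ (wk u @ v0)) @ (wk u @ v0)) (invR @ wk r))).
Proof.
unfold asymptotic, ultimately; intros H; apply (holds_allE r) in H; revert H.
unfold finst; rewrite fsubst_Ex, fsubst_All, fsubst_Imp, fsubst_le0, fren_fsubst, !fsubst_leR.
cbn [subst rsub upr]; rewrite !subst_invR, !subst_ups_wk, !subst_scons_wk, !subst_ids.
rewrite <- !ren_subst, !ren_upr_wk.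
exact (fun H => H).
Qed.

Lemma fwk_asymptotic (G : ctx) s (U : term G (tX ~> tX)) u :
  fwk (s := s) (asymptotic U u) = asymptotic (wk U) (wk u).
Proof.
unfold asymptotic; rewrite fwk_fsubst, fsubst_All, fsubst_Ex, fsubst_All, fsubst_Imp, fsubst_le0,
  fsubst_leR.
cbn [subst]; rewrite !subst_invR, !subst_ups_wk, <- !wk_subst; reflexivity.
Qed.

Lemma subst_shift3 (G : ctx) r s s' t (a : term G t) :
  subst (fun t v => Var (vs (s := r) (vs (s := s) (vs (s := s') v)))) a = wk (wk (wk a)).
Proof. rewrite !wk_subst, !subst_subst; reflexivity. Qed.

Section Minimizer.
Context {G : ctx} (T : theory G) (l : nat).
Variables (U : Fin.t l -> term G (tX ~> tX)) (u : term G (tN ~> tX)).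
Variables a b : term (tX :: G) one.

(* The matrix of [y in F -> a(y) < b(y)]: a single precision [n] either refutes [y in F]
   or confirms [a(y) < b(y)]. *)
Let B : form (tN :: tX :: G) :=
  Imp (bigAnd (fun j => eq_at (wk (cd @ (wk (U j) @ v0) @ v0)) (wk (natR @ num 0)) v0))
      (lt_at (wk a) (wk b) v0).

Lemma precision_exists :
  T (All tX (Imp (inF (fun j => wk (U j)) v0) (ltR a b))) -> T (All tX (Ex tN B)).
Proof.
intros H; apply holds_All; intros T1 E1.
rewrite holds_All in H; specialize (H T1 E1); rewrite holds_Imp in H.
unfold inF in H; rewrite holds_bigAnd in H; rewrite holds_Ex.
(* A witness of [a < b] is itself a suitable n. Otherwise y lies outside F, and a precision at which
   one of the equations fails makes the premise of [B] false. *)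
destruct (classic (T1 (ltR a b))) as [L | N].
- change (ltR a b) with (Ex tN (lt_at (wk a) (wk b) v0)) in L.
  rewrite holds_Ex in L; destruct L as [T2 [E2 L]].
  exists T2; split; [exact E2 |]; apply holds_Imp; auto.
- destruct (not_all_ex_not _ _ (fun X => N (H X))) as [j Nj].
  change (~ T1 (All tN (eq_at (wk (cd @ (wk (U j) @ v0) @ v0)) (wk (natR @ num 0)) v0))) in Nj.
  rewrite holds_All in Nj; apply not_all_ex_not in Nj; destruct Nj as [T2 Nj].
  apply imply_to_and in Nj; destruct Nj as [E2 Nj].
  exists T2; split; [exact E2 |]; apply holds_Imp; rewrite holds_bigAnd; intros X.
  contradiction (Nj (X j)).
Qed.

Lemma ultimately_lt :
  (forall j, T (asymptotic (U j) u)) ->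
  T (All tX (Imp (inF (fun j => wk (U j)) v0) (ltR a b))) ->
  T (ultimately (fsubst (scons (wk u @ v0) (rsub (@shift G tN))) (ltR a b))).
Proof.
intros Hu H.
destruct (@collection_X G T B) as [T1 [E1 C]].
{ apply qf_imp; [apply qf_bigAnd; intros j; apply qf_and |]; apply qf_eq. }
{ apply precision_exists, H. }
(* The bound N from collection is the new variable of [T1]. Moving the goal there allows asymptotic
   regularity to be used with a tolerance that depends on N. *)
apply E1; rewrite fwk_ultimately.
refine (ultimately_mono _ (ultimately_bigAnd (A := fun j =>
  leR (cd @ (wk (wk (U j)) @ (wk (wk u) @ v0)) @ (wk (wk u) @ v0)) (invR @ wk (pow2 @ v0))) _)).
2: { intros j; apply asymptotic_ultimately; rewrite <- fwk_asymptotic; apply E1, Hu. }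
apply holds_All; intros T2 E2; apply holds_Imp; rewrite holds_bigAnd; intros small.
set (y := wk (wk u) @ v0) in *.
(* In [T3] the precision belonging to y = u_m is [v0], the index m is [v1] and N is [v2]. As [v0] <=
   N, smallness yields the premise of [B] at [v0], and [v0] then witnesses the strict inequality. *)
destruct (C tN T2 y E2) as [T3 [E3 [L HB]]].
unfold B in HB; rewrite fsubst_Imp, holds_Imp, fsubst_bigAnd, holds_bigAnd, fsubst_lt_at in HB.
rewrite fren_fsubst, fsubst_fsubst, fsubst_ltR.
match goal with |- holds _ (ltR ?x ?z) =>
  change (T2 (Ex tN (lt_at (wk x) (wk z) v0))) end.
apply holds_Ex; exists T3; split; [exact E3 |].
assert (Eab : forall t (c : term (tX :: G) t),
  wk (s := tN) (subst (scomp (rsub (upr (@shift G tN))) (scons (wk u @ v0) (rsub (@shift G tN)))) c)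
  = subst (scons (wk y) (fun t v => Var (vs (vs (vs v))))) c).
{ intros t c; rewrite wk_subst, subst_subst; apply subst_ext; apply var_split.
  - unfold y, scomp; cbn [scons vcase]; rewrite <- wk_subst.
    cbn [subst]; rewrite <- ren_subst, ren_upr_wk; reflexivity.
  - reflexivity. }
rewrite !Eab; rewrite !subst_scons_wk in HB; apply HB.
intros j; rewrite fsubst_eq_at, !subst_scons_wk; cbn [subst].
rewrite subst_scons_wk, subst_natR.
assert (D := small j); apply E3 in D; rewrite fwk_fsubst, fsubst_leR in D.
cbn [subst] in D; rewrite subst_invR, <- !wk_subst in D.
apply holds_And; apply (@dist_lt_inv _ T3 _ (wk y) v2 v0); [| exact L].
rewrite subst_shift3; exact D.
Qed.
End Minimizer.

(** For each i the previous result is applied with [a] the constant [phi_i(x,x)] and [b] the term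
    [phi_i(x,y) + 1/(k+1)]. The value at u_m arises by substitution for y, so no continuity enters;
    finitely many thresholds are then combined. *)
Lemma almost_min_ultimately (G : ctx) (T : theory G) l (U : Fin.t l -> term G (tX ~> tX))
    (p : Fin.t l -> term G (tX ~> tX ~> one)) (u : term G (tN ~> tX)) (k : term G tN)
    (x : term G tX) :
  (forall j, T (asymptotic (U j) u)) ->
  T (All tX (Imp (inF (fun j => wk (U j)) v0)
    (almost_min (fun j => wk (p j)) (wk k) (wk x) v0))) ->
  T (Ex tN (All tN (Imp (le0 v1 v0)
    (almost_min (fun j => wk (wk (p j))) (wk (wk k)) (wk (wk x)) (wk (wk u) @ v0))))).
Proof.
intros Hu H.
assert (X : T (ultimately (almost_min (fun j => wk (p j)) (wk k) (wk x) (wk u @ v0)))).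
{ apply ultimately_bigAnd; intros i.
  assert (Hi : T (All tX (Imp (inF (fun j => wk (U j)) v0)
    (ltR (wk (p i) @ wk x @ wk x) (addR @ (wk (p i) @ wk x @ v0) @ (invR @ wk k)))))).
  { rewrite holds_All in H |- *; intros T1 E1; specialize (H T1 E1).
    rewrite holds_Imp in H |- *; intros F; specialize (H F).
    unfold almost_min in H; rewrite holds_bigAnd in H; apply H. }
  apply (ultimately_lt Hu) in Hi; revert Hi.
  rewrite fsubst_ltR; cbn [subst]; rewrite !subst_addR, !subst_invR, !subst_scons_wk, <- !wk_subst.
  exact (fun X => X). }
revert X; unfold ultimately, almost_min; rewrite fren_bigAnd.
erewrite bigAnd_ext; [exact (fun X => X) |].
intros i; cbv beta; rewrite fren_fsubst, fsubst_ltR; cbn [subst].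
rewrite !subst_addR, !subst_invR, <- !ren_subst, !ren_upr_wk; reflexivity.
Qed.

Theorem proposition6p1 (l : nat) (hl : 0 < l) :
  TMplus_proves (closure (G := data l)
    (Imp
      (bigAnd (fun i => asymptotic (Umap i) useq))
      (Imp
        (* forall k, exists x in F, forall y in F, forall i < l *)
        (All tN (Ex tX (And
          (inF (fun i => wk (wk (Umap i))) v0)
          (All tX (Imp
            (inF (fun i => wk (wk (wk (Umap i)))) v0)
            (almost_min (fun i => wk (wk (wk (phi i)))) v2 v1 v0))))))
        (* forall k, exists x in F, exists n, forall m >= n, forall i < l *)
        (All tN (Ex tX (And
          (inF (fun i => wk (wk (Umap i))) v0)
          (Ex tN (All tN (Imp
            (le0 v1 v0)
            (almost_min (fun i => wk (wk (wk (wk (phi i))))) v3 v2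
               (wk (wk (wk (wk useq))) @ v0))))))))))).
Proof.
apply derives_closure, derives_of_theories; intros T.
apply holds_Imp; rewrite holds_bigAnd; intros Hu.
apply holds_Imp; intros H.
apply holds_All; intros T1 E1.
rewrite holds_All in H; specialize (H T1 E1).
(* The x provided for k is kept: passing to the same extension [T2] makes it the witness in the
   conclusion. *)
rewrite holds_Ex in H |- *; destruct H as [T2 [E2 H]]; exists T2; split; [exact E2 |].
rewrite holds_And in H |- *; destruct H as [xF H]; split; [exact xF |].
apply (@almost_min_ultimately _ T2 l (fun i => wk (wk (Umap i))) (fun i => wk (wk (phi i)))
  (wk (wk useq)) v1 v0); [| exact H].
intros j; rewrite <- !fwk_asymptotic; apply E2, E1, Hu.
Qed.
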